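(* Let $\Phi,\Psi\in \mathcal{S}_p^*(Z)$ for some real $p\geq 0$. Then their $p$-covariant $\mathrm{Cov}_p(\Phi,\Psi)$ makes sense (i.e. the series defining it converges absolutely), and moreover $$\mathrm{Cov}_p(\Phi,\Psi)=\sum_{k=0}^{\infty}\big\langle \mathfrak{E}_k\mathfrak{a}_k^{\dag}\mathfrak{a}_k\Phi,\ \mathfrak{E}_k\mathfrak{a}_k^{\dag}\mathfrak{a}_k\Psi\big\rangle_{-p}.$$
   Context: $\mathbb{N}=\{0,1,2,\dots\}$ and $\Gamma$ is the set of all finite subsets of $\mathbb{N}$; for $\sigma\in\Gamma$, $k\in\mathbb{N}$, write $\sigma\cup k=\sigma\cup\{k\}$, $\sigma\setminus k=\sigma\setminus\{k\}$, and $\mathbf{1}_\sigma$ for the indicator of $\sigma$. $(\Omega,\mathcal{F},P)$ is a probability space with expectation $\mathbb{E}$. A discrete-time normal noise is a sequence $Z=(Z_n)_{n\in\mathbb{N}}$ of integrable (real) random variables on $\Omega$ with $\mathbb{E}[Z_n\mid\mathcal{F}_{n-1}]=0$ and $\mathbb{E}[Z_n^2\mid\mathcal{F}_{n-1}]=1$ for all $n\ge 0$, where $\mathcal{F}_{-1}=\{\emptyset,\Omega\}$ and $\mathcal{F}_n=\sigma(Z_k;0\le k\le n)$. Put $Z_\emptyset=1$ and $Z_\sigma=\prod_{i\in\sigma}Z_i$ for nonempty $\sigma\in\Gamma$; $\{Z_\sigma\mid\sigma\in\Gamma\}$ is an orthonormal system. Let $\mathcal{F}_\infty=\sigma(Z_n;n\in\mathbb{N})$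 and let $\mathcal{L}^2(Z)=\mathcal{L}^2(\Omega,\mathcal{F}_\infty,P)$ (complex-valued functions), with inner product $\langle\cdot,\cdot\rangle$ conjugate-linear in the first and linear in the second argument. $Z$ is a fixed discrete-time normal noise having the chaotic representation property: $\{Z_\sigma\}$ is total in $\mathcal{L}^2(Z)$, hence an orthonormal basis of it. $\lambda_\emptyset=1$ and $\lambda_\sigma=\prod_{k\in\sigma}(k+1)$ for nonempty $\sigma\in\Gamma$. For real $p\ge0$, $\mathcal{S}_p(Z)=\{\xi\in\mathcal{L}^2(Z)\mid\|\xi\|_p^2:=\sum_{\sigma\in\Gamma}\lambda_\sigma^{2p}|\langle Z_\sigma,\xi\rangle|^2<\infty\}$, a Hilbert space. $\mathcal{S}(Z)=\bigcap_{p\ge0}\mathcal{S}_p(Z)$ has the topology generated by the norms $\|\cdot\|_p$, $p\ge 0$; it is dense in each $\mathcal{S}_p(Z)$ and contains every $Z_\sigma$. $\mathcal{S}^*(Z)$ is the dual (continuous linear functionals) of $\mathcal{S}(Z)$ with the strong topology. $\mathcal{S}_p^*(Z)$ is the dual of $\mathcal{S}_p(Z)$ with dual norm $\|\cdot\|_{-p}$, regarded via restriction to $\mathcal{S}(Z)$ as a subspace of $\mathcal{S}^*(Z)$. For $\Phi\in\mathcal{S}^*(Z)$, its Fock transform is the function $\widehat\Phi(\sigma)=\Phi(Z_\sigma)$, $\sigma\in\Gamma$; $\Phi$ is determined by $\widehat\Phi$. Operators: for $k\ge 0$, $\mathfrak{a}_k$, $\mathfrak{a}_k^{\dag}$, $\mathfrak{E}$,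 $\mathfrak{E}_k$ are the (continuous linear) operators from $\mathcal{S}^*(Z)$ to itself determined by $\widehat{\mathfrak{a}_k\Phi}(\sigma)=[1-\mathbf{1}_\sigma(k)]\widehat\Phi(\sigma\cup k)$, $\widehat{\mathfrak{a}_k^{\dag}\Phi}(\sigma)=\mathbf{1}_\sigma(k)\widehat\Phi(\sigma\setminus k)$, $\widehat{\mathfrak{E}\Phi}(\sigma)=\widehat\Phi(\emptyset)\langle 1,Z_\sigma\rangle$, and $\widehat{\mathfrak{E}_k\Phi}(\sigma)=\mathbf{1}_{\Gamma_{k]}}(\sigma)\widehat\Phi(\sigma)$ for all $\sigma\in\Gamma$, where $\Gamma_{k]}=\{\sigma\in\Gamma\mid\max\sigma\le k\}$, with $\emptyset\in\Gamma_{k]}$. For $p\ge0$ and $\Phi,\Psi\in\mathcal{S}^*(Z)$, $\langle\Phi,\Psi\rangle_{-p}=\sum_{\sigma\in\Gamma}\lambda_\sigma^{-2p}\widehat\Phi(\sigma)\overline{\widehat\Psi(\sigma)}$ provided this series converges absolutely. The $p$-covariant of $\Phi,\Psi$ is $\mathrm{Cov}_p(\Phi,\Psi)=\langle\Phi-\mathfrak{E}\Phi,\Psi-\mathfrak{E}\Psi\rangle_{-p}$ provided the right-hand side makes sense. *)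

(* Defs.v *)
From HB Require Import structures.
From mathcomp Require Import all_boot all_order all_algebra finmap.
From mathcomp Require Import complex.
From mathcomp Require Import all_classical all_reals all_analysis.

Set Implicit Arguments.
Unset Strict Implicit.
Unset Printing Implicit Defensive.

Import Order.TTheory GRing.Theory Num.Theory.
Import numFieldNormedType.Exports.

Local Open Scope classical_set_scope.
Local Open Scope ring_scope.
Local Open Scope complex_scope.

Local Notation Re := complex.Re.
Local Notation Im := complex.Im.

Notation Gam := {fset nat}.

Section complex_sums.
Variable R : realType.

Definition cmod (z : R[i]) : R := Re `|z|.

(* Absolute convergence of an unordered series over a countable set. *)
Definition abs_summable (I : choiceType) (f : I -> R[i]) : Prop :=
  (\esum_(i in [set: I]) (cmod (f i))%:E < +oo)%E.

Definition rsum (I : choiceType) (f : I -> R) : R :=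
  fine (\esum_(i in [set: I]) (EFin \o f)^\+%E i
        - \esum_(i in [set: I]) (EFin \o f)^\-%E i)%E.

(* The sum of the series; meaningful when [abs_summable f]. *)
Definition csum (I : choiceType) (f : I -> R[i]) : R[i] :=
  rsum (fun i => Re (f i)) +i* rsum (fun i => Im (f i)).

End complex_sums.

Section noise.
Context (d : measure_display) (T : measurableType d) (R : realType).
Variables (P : probability T R) (Z : nat -> {RV P >-> R}).

Local Notation C := R[i].

(* sigma(Z_k; k in I) *)
Definition sigmaZ (I : set nat) : set_system T :=
  <<s \bigcup_(k in I) preimage_set_system setT (Z k) measurable >>.

(* [Fpast n] is F_{n-1}, so that [Fpast 0] is the trivial sigma-algebra. *)
Definition Fpast (n : nat) : set_system T := sigmaZ [set k | (k < n)%N].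
Definition Finf : set_system T := sigmaZ [set: nat].

Definition measurable_wrt (G : set_system T) (f : T -> R) : Prop :=
  preimage_set_system setT f measurable `<=` G.

(* [Y] is a version of E[X | G]. *)
Definition is_cond_exp (G : set_system T) (X Y : T -> R) : Prop :=
  [/\ P.-integrable setT (EFin \o X), P.-integrable setT (EFin \o Y),
      measurable_wrt G Y &
      forall A, G A -> \int[P]_(x in A) X x = \int[P]_(x in A) Y x].

Definition normal_noise : Prop := forall n,
  [/\ P.-integrable setT (EFin \o Z n),
      is_cond_exp (Fpast n) (Z n) (cst 0) &
      is_cond_exp (Fpast n) (fun x => Z n x ^+ 2) (cst 1)].

Definition Zs (s : Gam) : T -> C := fun x => (\prod_(i <- s) Z i x)%:C.

Definition lam (s : Gam) : R := \prod_(k <- s) k.+1%:R.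

Definition cexp (f : T -> C) : C :=
  (\int[P]_x Re (f x)) +i* (\int[P]_x Im (f x)).

Definition inner (xi eta : T -> C) : C := cexp (fun x => (xi x)^* * eta x).

(* The spaces L^2(Z), S_p(Z), S(Z) are sets of functions, not of classes modulo
   almost everywhere equality: the (semi)norms below vanish on the difference
   of two almost everywhere equal functions, hence every continuous linear
   functional factors through the quotient. *)
Definition L2Z : set (T -> C) := [set xi |
  [/\ measurable_wrt Finf (fun x => Re (xi x)),
      measurable_wrt Finf (fun x => Im (xi x)) &
      P.-integrable setT (fun x => (cmod (xi x) ^+ 2)%:E)]].

Definition norm2 (xi : T -> C) : R :=
  Num.sqrt (\int[P]_x (cmod (xi x) ^+ 2)).

(* The family {Z_s} is total in L^2(Z): its linear span is dense. *)
Definition chaotic_representation : Prop :=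
  forall xi, L2Z xi -> forall e : R, 0 < e ->
    exists (s : seq Gam) (c : Gam -> C),
      norm2 (fun x => xi x - \sum_(t <- s) c t * Zs t x) < e.

Definition sqnormp (p : R) (xi : T -> C) : \bar R :=
  \esum_(s in [set: Gam]) ((lam s `^ (2 * p)) * cmod (inner (Zs s) xi) ^+ 2)%:E.

Definition normp (p : R) (xi : T -> C) : R := Num.sqrt (fine (sqnormp p xi)).

Definition Sp (p : R) : set (T -> C) :=
  [set xi | L2Z xi /\ (sqnormp p xi < +oo)%E].

Definition Stest : set (T -> C) := \bigcap_(p in [set p : R | 0 <= p]) Sp p.

Definition functional := (T -> C) -> C.

Definition linear_on (V : set (T -> C)) (F : functional) : Prop :=
  forall (a : C) (xi eta : T -> C), V xi -> V eta ->
    F (fun x => a * xi x + eta x) = a * F xi + F eta.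

(* Continuity on [V] for the topology generated by the norms [normp q],
   [q] in [I]: a neighbourhood basis of [xi] consists of the finite
   intersections of balls centered at [xi]. *)
Definition continuous_on (V : set (T -> C)) (I : set R) (F : functional)
    : Prop :=
  forall xi, V xi -> forall e : R, 0 < e ->
    exists (qs : seq R) (r : R),
      [/\ forall q, q \in qs -> I q, 0 < r &
        forall eta, V eta ->
          (forall q, q \in qs -> normp q (fun x => eta x - xi x) < r) ->
          cmod (F eta - F xi) < e].

(* Functionals on [V] are represented by total functions which are 0 off [V],
   so that two functionals are equal as soon as they agree on [V]. *)
Definition dual_of (V : set (T -> C)) (I : set R) : set functional := [set F |
  [/\ linear_on V F, continuous_on V I F & forall xi, ~ V xi -> F xi = 0]].

Definition Sstar : set functional := dual_of Stest [set p | 0 <= p].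

(* S_p^*(Z) inside S^*(Z), via restriction to S(Z). *)
Definition Spstar (p : R) : set functional := [set Phi |
  Sstar Phi /\ exists2 F, dual_of (Sp p) [set p] F &
                          forall xi, Stest xi -> Phi xi = F xi].

Definition fock (Phi : functional) (s : Gam) : C := Phi (Zs s).

(* The element of S^*(Z) with Fock transform [f] (it is unique; the value 0 is
   returned if there is none, which does not happen for the four operators
   below applied to elements of S^*(Z)). *)
Definition of_fock (f : Gam -> C) : functional :=
  xget (fun=> 0) [set Psi | Sstar Psi /\ forall s, fock Psi s = f s].

Definition annih (k : nat) (Phi : functional) : functional :=
  of_fock (fun s => (1 - (k \in s)%:R) * fock Phi (k |` s)%fset).

Definition creat (k : nat) (Phi : functional) : functional :=
  of_fock (fun s => (k \in s)%:R * fock Phi (s `\ k)%fset).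

Definition expec (Phi : functional) : functional :=
  of_fock (fun s => fock Phi fset0 * inner (fun=> 1) (Zs s)).

(* The empty maximum is 0, so the empty set satisfies the condition. *)
Definition Gam_upto (k : nat) (s : Gam) : bool := (\max_(i <- s) i <= k)%N.

Definition cexpec (k : nat) (Phi : functional) : functional :=
  of_fock (fun s => (Gam_upto k s)%:R * fock Phi s).

Definition pairing_term (p : R) (Phi Psi : functional) (s : Gam) : C :=
  (lam s `^ (- (2 * p)))%:C * fock Phi s * (fock Psi s)^*.

Definition pairing_defined (p : R) (Phi Psi : functional) : Prop :=
  abs_summable (pairing_term p Phi Psi).

(* <Phi, Psi>_{-p}, meaningful when [pairing_defined p Phi Psi]. *)
Definition pairing (p : R) (Phi Psi : functional) : C :=
  csum (pairing_term p Phi Psi).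

Definition Cov_defined (p : R) (Phi Psi : functional) : Prop :=
  pairing_defined p (Phi \- expec Phi) (Psi \- expec Psi).

Definition Cov (p : R) (Phi Psi : functional) : C :=
  pairing p (Phi \- expec Phi) (Psi \- expec Psi).

(* E_k a_k^dagger a_k *)
Definition EAA (k : nat) (Phi : functional) : functional :=
  cexpec k (creat k (annih k Phi)).

End noise.

(* Main.v *)
(** The Fock transform of [Phi] in [S_p^*(Z)] lies in the [lam^(-2p)]-weighted
    l^2 space over the finite sets of naturals. Conversely every family [g] in
    that space is the Fock transform of the continuous functional
    [xi |-> \sum_s g(s) <Z_s, xi>]. Hence [E_k a_k^dagger a_k] multiplies the
    Fock transform by the indicator of [{s | s nonempty, max s = k}], whereas
    [Phi - E Phi] is obtained by multiplying with the indicator of the nonempty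
    sets. These are partitioned by their maximum, so the identity is a
    regrouping of one absolutely convergent series. *)

Require Import Defs.
From mathcomp Require Import all_boot all_order all_algebra finmap.
From mathcomp Require Import complex.
From mathcomp Require Import all_classical all_reals all_analysis.
From mathcomp Require Import measurable_realfun ring lra.
Import Order.TTheory GRing.Theory Num.Theory.
Import numFieldNormedType.Exports.
Local Open Scope classical_set_scope.
Local Open Scope ring_scope.

Set Implicit Arguments.
Unset Strict Implicit.
Unset Printing Implicit Defensive.

Import HBNNSimple.

Local Notation Re := complex.Re.
Local Notation Im := complex.Im.

(** Every operator is defined by [of_fock], a choice with the zero functional as default, so its
    Fock formula becomes available only after a continuous functional with that transform has been
    exhibited. Hence each use of [annih], [creat], [cexpec] or [expec] is preceded by a bound in the
    weighted space. The pairing reads only Fock transforms, so the chosen functional itself never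
    has to be identified. Evaluating the exhibited series at [Zs s] relies on orthonormality. The
    noise is not assumed independent, so even the square integrability of a product must be
    extracted from conditional expectations, by conditioning at the largest index; this is the
    purpose of the measure-theoretic part. The duality estimates use AM-GM with a free parameter in
    place of Cauchy-Schwarz: it is a termwise inequality and passes directly to unordered sums. *)

(** * Integrals against a factor measurable for a sub-sigma-algebra: nonnegative case *)

Section sub_sigma_algebra.
Context (d : measure_display) (T : measurableType d) (R : realType).
Variable P : {measure set T -> \bar R}.
Variables (G : set_system T).
Hypothesis GT : <<s G>> `<=` @measurable _ T.

Lemma measurable_wrtP (f : T -> R) :
  measurable_wrt <<s G>> f <->
  @measurable_fun _ _ (g_sigma_algebraType G) R setT f.
Proof.
split=> [mf _ Y mY|mf _ [Y mY <-]].
- by apply: mf; exists Y.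
- exact: (mf measurableT).
Qed.

Lemma measurable_wrt_measurable_fun (f : T -> R) :
  measurable_wrt <<s G>> f -> measurable_fun setT f.
Proof. by move=> mf _ Y mY; apply: GT; apply: mf; exists Y. Qed.

Local Open Scope ereal_scope.

(** Approximate [W] from below by simple functions whose level sets lie in [<<s G>>], then pass to
    the limit by monotone convergence. The identity is between extended reals, without integrability
    of the products, so it can later serve to prove that [zs s ^+ 2] is integrable. *)
Lemma ge0_integralM_sub (f g W : T -> R) :
  measurable_fun setT f -> measurable_fun setT g ->
  (forall x, (0 <= f x)%R) -> (forall x, (0 <= g x)%R) ->
  (forall A, <<s G>> A ->
    \int[P]_(x in A) (f x)%:E = \int[P]_(x in A) (g x)%:E) ->
  measurable_wrt <<s G>> W -> (forall x, (0 <= W x)%R) ->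
  \int[P]_x (W x * f x)%:E = \int[P]_x (W x * g x)%:E.
Proof.
move=> mf mg f0 g0 fg mW W0.
have mW' := (measurable_EFinP _ _).2 ((measurable_wrtP W).1 mW).
pose H n := nnsfun_approx measurableT mW' n.
(* [H n] is simple for the sigma-algebra generated by [G]; [h n] is the same function seen on [T]
   with its own sigma-algebra. *)
pose h n : T -> R := fun x : g_sigma_algebraType G => H n x.
have mHr n r : <<s G>> (h n @^-1` [set r]) by exact: (measurable_funPTI (H n)).
have mh n : measurable_fun [set: T] (h n).
  apply/measurable_wrt_measurable_fun/measurable_wrtP.
  exact: measurable_funPT.
have hcvg x : (h n x)%:E @[n --> \oo] --> (W x)%:E.
  apply: (@cvg_nnsfun_approx _ _ _ _ measurableT _ mW') => // y _.
  by rewrite lee_fin.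
have mono (k : T -> R) : measurable_fun setT k -> (forall x, (0 <= k x)%R) ->
    \int[P]_x (W x * k x)%:E = limn (fun n => \int[P]_x (h n x * k x)%:E).
  move=> mk k0; rewrite -monotone_convergence//.
  - apply: eq_integral => x _; apply/esym/cvg_lim => //.
    have := @hcvg x; move/(cvgeZr (y := (k x)%:E)) => /(_ isT).
    exact.
  - by move=> n; apply/measurable_EFinP; apply: measurable_funM.
  - by move=> n x _; rewrite lee_fin mulr_ge0//; exact: fun_ge0.
  - move=> x _ m n mn; rewrite lee_fin ler_wpM2r//.
    by have /lefP := nd_nnsfun_approx measurableT mW' mn; exact.
rewrite mono// mono//; congr (limn _); apply/funext => n.
pose s := fset_set (range (H n)).
(* Splitting [h n] over its finitely many values leaves integrals of [k] over level sets, which is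
   where [fg] applies. *)
have step (k : T -> R) : measurable_fun setT k -> (forall x, (0 <= k x)%R) ->
    \int[P]_x (h n x * k x)%:E =
    \sum_(i < #|` s|) (s`_i)%:E *
      \int[P]_(x in h n @^-1` [set s`_i]) (k x)%:E.
  move=> mk k0.
  have ms r : measurable (h n @^-1` [set r]).
    by apply: GT; exact: mHr.
  have s0 (i : 'I_(#|` s|)) : (0 <= s`_i)%R.
    have : s`_i \in s by rewrite mem_nth.
    by rewrite in_fset_set// inE => -[x _ <-]; exact: fun_ge0.
  transitivity (\int[P]_x (\sum_(i < #|` s|)
     (s`_i)%:E * ((k x)%:E * (\1_(h n @^-1` [set s`_i]) x)%:E))).
    apply: eq_integral => x _.
    rewrite [h n x](fimfunEord (H n)) mulr_suml -sumEFin.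
    by apply: eq_bigr => i _; rewrite -!EFinM; congr EFin; ring.
  have mk1 r : measurable_fun setT
      (fun x => (k x)%:E * (\1_(h n @^-1` [set r]) x)%:E).
    apply: emeasurable_funM; first exact/measurable_EFinP.
    exact/measurable_EFinP/measurable_indic.
  have k10 r x : 0 <= (k x)%:E * (\1_(h n @^-1` [set r]) x)%:E.
    by rewrite mule_ge0// lee_fin.
  rewrite ge0_integral_sum//.
  - apply: eq_bigr => i _; rewrite ge0_integralZl// ?lee_fin//.
    by rewrite [in RHS]integral_mkcond epatch_indic.
  - by move=> i; apply: measurable_funeM; exact: mk1.
  - by move=> i x _; rewrite mule_ge0// lee_fin.
rewrite step// step//; apply: eq_bigr => i _; congr (_ * _).
by apply: fg; exact: mHr.
Qed.
End sub_sigma_algebra.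

(** * The same identity for signed functions *)

Section real_integrals.
Context (d : measure_display) (T : measurableType d) (R : realType).
Variable P : {measure set T -> \bar R}.

Local Notation Int f := (P.-integrable setT (EFin \o f)).

Lemma integrable_le_norm (f g : T -> R) : measurable_fun setT f ->
  (forall x, `|f x| <= `|g x|) -> Int g -> Int f.
Proof.
move=> mf fg ig; apply: le_integrable ig => //.
- exact/measurable_EFinP.
- by move=> x _ /=; rewrite lee_fin.
Qed.

Lemma integrableD_EFin (f g : T -> R) :
  Int f -> Int g -> Int (fun x => f x + g x).
Proof. by move=> fi gi; have := integrableD measurableT fi gi. Qed.

Lemma integrableB_EFin (f g : T -> R) :
  Int f -> Int g -> Int (fun x => f x - g x).
Proof. by move=> fi gi; have := integrableB measurableT fi gi. Qed.

Lemma integrableZ_EFin (a : R) (f : T -> R) :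
  Int f -> Int (fun x => a * f x).
Proof. by move=> fi; have := integrableZl measurableT a fi. Qed.

Lemma integrable_norm_EFin (f : T -> R) : Int f -> Int (fun x => `|f x|).
Proof. by move=> fi; have := integrable_norm fi. Qed.

Lemma integrableM_sqr (f g : T -> R) :
  measurable_fun setT f -> measurable_fun setT g ->
  Int (fun x => f x ^+ 2) -> Int (fun x => g x ^+ 2) ->
  Int (fun x => f x * g x).
Proof.
move=> mf mg fi gi.
apply: (@integrable_le_norm _ (fun x => f x ^+ 2 + g x ^+ 2)).
- exact: measurable_funM.
- move=> x; rewrite [leRHS]ger0_norm ?addr_ge0 ?sqr_ge0// normrM.
  rewrite -[f x ^+ 2]real_normK ?num_real// -[g x ^+ 2]real_normK ?num_real//.
  have := normr_ge0 (f x); have := normr_ge0 (g x); nra.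
- exact: integrableD_EFin.
Qed.

Variables (G : set_system T).
Hypothesis GT : <<s G>> `<=` @measurable _ T.

Lemma RintegralM_sub (X Y W : T -> R) :
  Int X -> Int Y ->
  (forall A, <<s G>> A -> \int[P]_(x in A) X x = \int[P]_(x in A) Y x) ->
  measurable_wrt <<s G>> W ->
  Int (fun x => W x * X x) -> Int (fun x => W x * Y x) ->
  \int[P]_x (W x * X x) = \int[P]_x (W x * Y x).
Proof.
move=> iX iY XY mW iWX iWY.
pose M x := `|X x| + `|Y x|.
have mWT := measurable_wrt_measurable_fun GT mW.
have meas (f : T -> R) : Int f -> measurable_fun setT f.
  by move=> /integrableP[/measurable_EFinP].
have iM : Int M by apply: integrableD_EFin; exact: integrable_norm_EFin.
(* Adding [M] to [X] and [Y], and [`|W|] to [W], makes everything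
   nonnegative. *)
pose f x := X x + M x; pose g x := Y x + M x.
have if_ : Int f by exact: integrableD_EFin.
have ig : Int g by exact: integrableD_EFin.
have f0 x : 0 <= f x.
  by rewrite /f /M; have := ler_norm (- X x); rewrite normrN;
     have := normr_ge0 (Y x); lra.
have g0 x : 0 <= g x.
  by rewrite /g /M; have := ler_norm (- Y x); rewrite normrN;
     have := normr_ge0 (X x); lra.
pose W1 x := W x + `|W x|; pose W2 x := `|W x|.
have mW1 : measurable_wrt <<s G>> W1.
  apply/measurable_wrtP; apply: measurable_funD; first exact/measurable_wrtP.
  by apply: measurableT_comp => //; exact/measurable_wrtP.
have mW2 : measurable_wrt <<s G>> W2.
  apply/measurable_wrtP.
  by apply: measurableT_comp => //; exact/measurable_wrtP.
have W10 x : 0 <= W1 x.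
  by rewrite /W1; have := ler_norm (- W x); rewrite normrN; lra.
have W20 x : 0 <= W2 x by exact: normr_ge0.
have Efg A : <<s G>> A ->
    (\int[P]_(x in A) (f x)%:E = \int[P]_(x in A) (g x)%:E)%E.
  move=> GA; have mA := GT GA.
  have sub (h : T -> R) : Int h -> P.-integrable A (EFin \o h).
    by move=> ih; apply: integrableS ih.
  rewrite -[LHS]fineK; last exact/integrable_fin_num/sub.
  rewrite -[RHS]fineK; last exact/integrable_fin_num/sub.
  congr EFin; change (\int[P]_(x in A) f x = \int[P]_(x in A) g x).
  rewrite (RintegralD mA (sub _ iX) (sub _ iM)).
  by rewrite (RintegralD mA (sub _ iY) (sub _ iM)) XY.
(* The bounds with constant 2 cover [W1], [W2], [f], [g] at once and dominate each product by
   [4 |W X| + 4 |W Y|], integrable by hypothesis. *)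
have iW (V h : T -> R) : (forall x, `|V x| <= 2 * `|W x|) ->
    measurable_fun setT V ->
    Int h -> (forall x, `|h x| <= 2 * `|X x| + 2 * `|Y x|) ->
    Int (fun x => V x * h x).
  move=> VW mV ih hXY.
  apply: (@integrable_le_norm _
    (fun x => 4 * `|W x * X x| + 4 * `|W x * Y x|)).
  - by apply: measurable_funM => //; exact: meas.
  - move=> x; rewrite [leRHS]ger0_norm ?addr_ge0 ?mulr_ge0//.
    rewrite !normrM; apply: le_trans (ler_pM _ _ (VW x) (hXY x)) _ => //.
    by rewrite le_eqVlt; apply/orP; left; apply/eqP; ring.
  - by apply: integrableD_EFin; apply: integrableZ_EFin;
       exact: integrable_norm_EFin.
have W1W x : `|W1 x| <= 2 * `|W x|.
  by rewrite ger0_norm// /W1; have := ler_norm (W x); lra.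
have W2W x : `|W2 x| <= 2 * `|W x|.
  by rewrite ger0_norm// /W2; have := normr_ge0 (W x); lra.
have fXY x : `|f x| <= 2 * `|X x| + 2 * `|Y x|.
  by rewrite ger0_norm// /f /M; have := ler_norm (X x);
     have := normr_ge0 (Y x); lra.
have gXY x : `|g x| <= 2 * `|X x| + 2 * `|Y x|.
  by rewrite ger0_norm// /g /M; have := ler_norm (Y x);
     have := normr_ge0 (X x); lra.
have mW1T := measurable_wrt_measurable_fun GT mW1.
have mW2T := measurable_wrt_measurable_fun GT mW2.
have mf := meas _ if_; have mg := meas _ ig.
have E1 : \int[P]_x (W1 x * f x) = \int[P]_x (W1 x * g x).
  by rewrite /Rintegral (@ge0_integralM_sub _ _ _ P G GT f g).
have E2 : \int[P]_x (W2 x * f x) = \int[P]_x (W2 x * g x).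
  by rewrite /Rintegral (@ge0_integralM_sub _ _ _ P G GT f g).
have split (V h : T -> R) : Int (fun x => W1 x * h x) ->
    Int (fun x => W2 x * h x) ->
    \int[P]_x (W x * h x) = \int[P]_x (W1 x * h x) - \int[P]_x (W2 x * h x).
  move=> i1 i2; rewrite -RintegralB//; apply: eq_Rintegral => x _.
  by rewrite /W1 /W2; ring.
have iWM : Int (fun x => W x * M x).
  apply: iW => //.
  - by move=> x; have := normr_ge0 (W x); lra.
  - move=> x; rewrite ger0_norm /M ?addr_ge0//.
    by have := normr_ge0 (X x); have := normr_ge0 (Y x); lra.
(* The shift [M] is the same in [f] and [g], so the integral of [W * M] cancels. *)
suff : \int[P]_x (W x * f x) = \int[P]_x (W x * g x).
  have -> : \int[P]_x (W x * f x) =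
      \int[P]_x (W x * X x) + \int[P]_x (W x * M x).
    rewrite -RintegralD//; apply: eq_Rintegral => x _.
    by rewrite /f; ring.
  have -> : \int[P]_x (W x * g x) =
      \int[P]_x (W x * Y x) + \int[P]_x (W x * M x).
    rewrite -RintegralD//; apply: eq_Rintegral => x _.
    by rewrite /g; ring.
  by move/addIr.
rewrite !split//.
- by rewrite E1 E2.
- exact: iW.
- exact: iW.
- exact: iW.
- exact: iW.
Qed.
End real_integrals.

(** * Orthonormality of the products of the noise *)

Section orthonormality.
Context (d : measure_display) (T : measurableType d) (R : realType).
Variables (P : probability T R) (Z : nat -> {RV P >-> R}).

Local Notation Int f := (P.-integrable setT (EFin \o f)).

Definition zs (s : Gam) (x : T) : R := \prod_(i <- s) Z i x.

Lemma sigmaZ_measurable (I : set nat) : sigmaZ Z I `<=` @measurable _ T.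
Proof.
apply: smallest_sub; first exact: sigma_algebra_measurable.
by move=> A [k _ [B mB <-]]; exact: measurable_funPT.
Qed.

Lemma measurable_zs (I : set nat) (s : Gam) :
  (forall i, i \in s -> I i) -> measurable_wrt (sigmaZ Z I) (zs s).
Proof.
move=> sI; apply/measurable_wrtP.
have {}sI : forall i, i \in enum_fset s -> I i by [].
rewrite /zs; elim: (enum_fset s) sI => [|i l IH] lI.
  rewrite (_ : (fun _ => _) = cst 1); first exact: measurable_cst.
  by apply/funext => x; rewrite big_nil.
rewrite (_ : (fun _ => _) = (fun x => Z i x * \prod_(j <- l) Z j x));
  last first.
  by apply/funext => x; rewrite big_cons.
apply: measurable_funM; last first.
  by apply: IH => j jl; apply: lI; rewrite inE jl orbT.
apply/measurable_wrtP => A AZ; apply: sub_sigma_algebra; exists i => //.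
by apply: lI; rewrite inE eqxx.
Qed.

Lemma measurable_zsT (s : Gam) : measurable_fun setT (zs s).
Proof.
apply: (measurable_wrt_measurable_fun (@sigmaZ_measurable setT)).
exact: measurable_zs.
Qed.

Lemma zs0 : zs fset0 = cst 1.
Proof. by apply/funext => x; rewrite /zs big_seq_fset0. Qed.

Lemma zsD1 (s : Gam) n x : n \in s -> zs s x = Z n x * zs (s `\ n)%fset x.
Proof. by move=> ns; rewrite /zs (big_fsetD1 n). Qed.

Hypothesis hZ : normal_noise Z.

(** Induction on a strict bound [n] for the indices, conditioning on the past of the top index. If
    it lies in both sets, the conditional second moment 1 removes it from both; if it lies in
    exactly one, the conditional mean 0 kills the integral. *)
Lemma zs_orthonormal (s t : Gam) :
  Int (fun x => zs s x * zs t x) /\ \int[P]_x (zs s x * zs t x) = (s == t)%:R.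
Proof.
(* Square integrability is carried along in the induction, because [RintegralM_sub] asks for
   integrable products. *)
suff H n : (forall s : Gam, (forall i, i \in s -> (i < n)%N) ->
      Int (fun x => zs s x ^+ 2)) /\
    (forall s t : Gam, (forall i, i \in s -> (i < n)%N) ->
      (forall i, i \in t -> (i < n)%N) ->
      \int[P]_x (zs s x * zs t x) = (s == t)%:R).
  pose n := (\max_(i <- (s `|` t)%fset) i).+1.
  have nP i : i \in (s `|` t)%fset -> (i < n)%N.
    by move=> ist; rewrite ltnS; apply: (leq_bigmax_seq _ ist).
  have ns i : i \in s -> (i < n)%N by move=> h; apply: nP; rewrite inE h.
  have nt i : i \in t -> (i < n)%N by move=> h; apply: nP; rewrite inE h orbT.
  have [Hi He] := H n; split; last exact: He.
  by apply: integrableM_sqr; [exact: measurable_zsT|exact: measurable_zsT|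
    exact: Hi|exact: Hi].
elim: n => [|n [IHi IHe]] {s t}.
  have s0 (s : Gam) : (forall i, i \in s -> (i < 0)%N) -> s = fset0.
    by move=> h; apply/fsetP => i; rewrite inE; apply/negP => /h.
  have i1 : Int (fun=> 1 : R) by exact: finite_measure_integrable_cst.
  split=> [s /s0 ->|s t /s0 -> /s0 ->].
    by rewrite zs0; under eq_fun do rewrite expr1n.
  rewrite zs0 eqxx; under eq_Rintegral do rewrite mul1r.
  by rewrite Rintegral_cst// mul1r; exact: (congr1 fine (probability_setT P)).
have [iZ [_ _ _ cZ] [iZ2 i1 _ cZ2]] := hZ n.
have GT := @sigmaZ_measurable [set k | (k < n)%N].
have D1lt (s : Gam) : (forall i, i \in s -> (i < n.+1)%N) ->
    forall i, i \in (s `\ n)%fset -> (i < n)%N.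
  move=> h i; rewrite !inE => /andP[iNn /h]; rewrite ltnS leq_eqVlt.
  by rewrite (negbTE iNn).
have notin (s : Gam) : (forall i, i \in s -> (i < n.+1)%N) -> n \notin s ->
    forall i, i \in s -> (i < n)%N.
  move=> h ns i si; move: (h _ si); rewrite ltnS leq_eqVlt => /predU1P[e|//].
  by move: ns; rewrite -e si.
have Hi (s : Gam) : (forall i, i \in s -> (i < n.+1)%N) ->
    Int (fun x => zs s x ^+ 2).
  move=> hs; have [ns|ns] := boolP (n \in s); last exact/IHi/notin.
  have E x : zs s x ^+ 2 = zs (s `\ n)%fset x ^+ 2 * Z n x ^+ 2.
    by rewrite (zsD1 x ns) exprMn mulrC.
  have mW : measurable_wrt (Fpast Z n) (fun x => zs (s `\ n)%fset x ^+ 2).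
    apply/measurable_wrtP; apply: measurable_funX; apply/measurable_wrtP.
    by apply: measurable_zs => i; exact: D1lt.
  (* The integral of the square is computed in the extended reals: conditioning replaces
     [Z n x ^+ 2] by 1, so it equals the integral for [s] without [n], finite by induction. *)
  apply/integrableP; split.
    by apply/measurable_EFinP; apply: measurable_funX; exact: measurable_zsT.
  have /integrableP[_] := IHi _ (D1lt _ hs).
  congr (_ < _)%E.
  transitivity (\int[P]_x (zs (s `\ n)%fset x ^+ 2 * 1)%:E)%E.
    apply: eq_integral => x _.
    by rewrite mulr1 /= ger0_norm// sqr_ge0.
  transitivity (\int[P]_x (zs (s `\ n)%fset x ^+ 2 * Z n x ^+ 2)%:E)%E.
    apply/esym/(ge0_integralM_sub GT) => //.
    - by apply: measurable_funX; exact: measurable_funPT.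
    - by move=> x; exact: sqr_ge0.
    - move=> A GA; have mA := GT _ GA.
      rewrite -[LHS]fineK; last first.
        by apply: integrable_fin_num => //; apply: integrableS iZ2.
      rewrite -[RHS]fineK; last first.
        by apply: integrable_fin_num => //; apply: integrableS i1.
      by congr EFin; exact: cZ2.
    - by move=> x; exact: sqr_ge0.
  apply: eq_integral => x _.
  by rewrite /= -E ger0_norm// sqr_ge0.
split => // s t hs ht.
have iP (u v : Gam) : (forall i, i \in u -> (i < n.+1)%N) ->
    (forall i, i \in v -> (i < n.+1)%N) -> Int (fun x => zs u x * zs v x).
  by move=> hu hv; apply: integrableM_sqr; [exact: measurable_zsT|
    exact: measurable_zsT|exact: Hi|exact: Hi].
have one (u v : Gam) : (forall i, i \in u -> (i < n.+1)%N) ->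
    (forall i, i \in v -> (i < n.+1)%N) -> n \in u -> n \notin v ->
    \int[P]_x (zs u x * zs v x) = 0.
  move=> hu hv nu nv.
  have E x : zs u x * zs v x = (zs (u `\ n)%fset x * zs v x) * Z n x.
    by rewrite (zsD1 x nu); ring.
  under eq_Rintegral do rewrite E.
  have mW : measurable_wrt (Fpast Z n)
      (fun x => zs (u `\ n)%fset x * zs v x).
    apply/measurable_wrtP; apply: measurable_funM; apply/measurable_wrtP;
      apply: measurable_zs => i; [exact: D1lt|exact: notin].
  rewrite (RintegralM_sub GT iZ _ cZ mW).
  - by under eq_Rintegral do rewrite mulr0; rewrite Rintegral_cst// mul0r.
  - exact: finite_measure_integrable_cst.
  - by under eq_fun do rewrite -E; exact: iP.
  - under eq_fun do rewrite mulr0; exact: finite_measure_integrable_cst.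
have [ns|ns] := boolP (n \in s); have [nt|nt] := boolP (n \in t).
- have E x : zs s x * zs t x =
      (zs (s `\ n)%fset x * zs (t `\ n)%fset x) * Z n x ^+ 2.
    by rewrite (zsD1 x ns) (zsD1 x nt); ring.
  have mW : measurable_wrt (Fpast Z n)
      (fun x => zs (s `\ n)%fset x * zs (t `\ n)%fset x).
    by apply/measurable_wrtP; apply: measurable_funM; apply/measurable_wrtP;
      apply: measurable_zs => i; exact: D1lt.
  have iW : Int (fun x => zs (s `\ n)%fset x * zs (t `\ n)%fset x).
    by apply: integrableM_sqr; [exact: measurable_zsT|exact: measurable_zsT|
      exact/IHi/D1lt|exact/IHi/D1lt].
  under eq_Rintegral do rewrite E.
  rewrite (RintegralM_sub GT iZ2 i1 cZ2 mW).
  - under eq_Rintegral do rewrite mulr1.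
    rewrite IHe; [|exact: D1lt|exact: D1lt].
    congr (_%:R); congr nat_of_bool; apply/eqP/eqP => [e|->//].
    by rewrite -(fsetD1K ns) e fsetD1K.
  - by under eq_fun do rewrite -E; exact: iP.
  - by under eq_fun do rewrite mulr1.
- rewrite one//; case: eqP => // e; by rewrite e (negbTE nt) in ns.
- under eq_Rintegral do rewrite mulrC.
  rewrite one//; case: eqP => // e; by rewrite e nt in ns.
- by apply: IHe; exact: notin.
Qed.

End orthonormality.

(** * Modulus, real and imaginary parts *)

Section cmod.
Local Open Scope complex_scope.
Variable R : realType.
Implicit Types z w : R[i].

Lemma cmodE z : cmod z = Normc.normc z. Proof. by []. Qed.

Lemma cmod_ge0 z : 0 <= cmod z.
Proof. by rewrite cmodE; case: z => a b; exact: sqrtr_ge0. Qed.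

Lemma cmodM z w : cmod (z * w) = cmod z * cmod w.
Proof. by rewrite !cmodE Normc.normcM. Qed.

Lemma cmodD z w : cmod (z + w) <= cmod z + cmod w.
Proof. by rewrite !cmodE; exact: le_normcD. Qed.

Lemma sqr_cmod z : cmod z ^+ 2 = Re z ^+ 2 + Im z ^+ 2.
Proof.
by rewrite cmodE; case: z => a b /=; rewrite sqr_sqrtr// addr_ge0// sqr_ge0.
Qed.

Lemma normc_cmod z : `|z| = (cmod z)%:C. Proof. by []. Qed.

Lemma cmod_conj z : cmod (Num.conj z) = cmod z.
Proof. by rewrite !cmodE; case: z => a b /=; rewrite sqrrN. Qed.

Lemma cmodR (a : R) : cmod a%:C = `|a|.
Proof. by rewrite cmodE /= expr0n/= addr0 sqrtr_sqr. Qed.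

Lemma Re_le_cmod z : `|Re z| <= cmod z.
Proof.
rewrite -(ler_sqr (normr_ge0 _) (cmod_ge0 _)) sqr_cmod.
by rewrite real_normK ?num_real// lerDl sqr_ge0.
Qed.

Lemma Im_le_cmod z : `|Im z| <= cmod z.
Proof.
rewrite -(ler_sqr (normr_ge0 _) (cmod_ge0 _)) sqr_cmod.
by rewrite real_normK ?num_real// lerDr sqr_ge0.
Qed.

Lemma cmod_le z : cmod z <= `|Re z| + `|Im z|.
Proof.
have h : 0 <= `|Re z| + `|Im z| by rewrite addr_ge0.
rewrite -(ler_sqr (cmod_ge0 _) h) sqr_cmod.
rewrite -(real_normK (num_real (Re z))) -(real_normK (num_real (Im z))).
by have := normr_ge0 (Re z); have := normr_ge0 (Im z); nra.
Qed.

Lemma cmod0 : cmod (0 : R[i]) = 0.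
Proof. by rewrite (cmodR 0) normr0. Qed.

Lemma sqr_cmodD z w : cmod (z + w) ^+ 2 <= 2 * cmod z ^+ 2 + 2 * cmod w ^+ 2.
Proof.
apply: (@le_trans _ _ ((cmod z + cmod w) ^+ 2)).
  by rewrite ler_sqr ?nnegrE ?addr_ge0 ?cmod_ge0// cmodD.
by have := sqr_ge0 (cmod z - cmod w); lra.
Qed.

Lemma ReM z w : Re (z * w) = Re z * Re w - Im z * Im w.
Proof. by case: z w => [a b] [a' b']. Qed.

Lemma ImM z w : Im (z * w) = Re z * Im w + Im z * Re w.
Proof. by case: z w => [a b] [a' b']. Qed.

Lemma ReD z w : Re (z + w) = Re z + Re w.
Proof. by case: z w => [a b] [a' b']. Qed.

Lemma ImD z w : Im (z + w) = Im z + Im w.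
Proof. by case: z w => [a b] [a' b']. Qed.

End cmod.

(** * The space [L2Z] and the coefficients along [Zs] *)

Section L2.
Local Open Scope complex_scope.
Context (d : measure_display) (T : measurableType d) (R : realType).
Variables (P : probability T R) (Z : nat -> {RV P >-> R}).

Local Notation Int f := (P.-integrable setT (EFin \o f)).

Let mZ := @sigmaZ_measurable _ _ _ P Z setT.

Lemma L2ZP (xi : T -> R[i]) : L2Z Z xi <->
  [/\ measurable_wrt (Finf Z) (fun x => Re (xi x)),
      measurable_wrt (Finf Z) (fun x => Im (xi x)),
      Int (fun x => Re (xi x) ^+ 2) & Int (fun x => Im (xi x) ^+ 2)].
Proof.
have mT (f : T -> R) : measurable_wrt (Finf Z) f -> measurable_fun setT f.
  by move=> mf; exact: (measurable_wrt_measurable_fun mZ mf).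
split=> [[mRe mIm i]|[mRe mIm iRe iIm]]; split => //.
- apply: integrable_le_norm i => [|x].
    by apply: measurable_funX; exact: mT.
  by rewrite sqr_cmod !ger0_norm ?addr_ge0 ?sqr_ge0// lerDl sqr_ge0.
- apply: integrable_le_norm i => [|x].
    by apply: measurable_funX; exact: mT.
  by rewrite sqr_cmod !ger0_norm ?addr_ge0 ?sqr_ge0// lerDr sqr_ge0.
- under eq_fun do rewrite sqr_cmod.
  exact: (integrableD_EFin iRe iIm).
Qed.

Lemma integrable_sqrD (a b : R) (f g : T -> R) :
  measurable_fun setT f -> measurable_fun setT g ->
  Int (fun x => f x ^+ 2) -> Int (fun x => g x ^+ 2) ->
  Int (fun x => (a * f x + b * g x) ^+ 2).
Proof.
move=> mf mg fi gi.
apply: (@integrable_le_norm _ _ _ _ _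
  (fun x => (2 * a ^+ 2) * f x ^+ 2 + (2 * b ^+ 2) * g x ^+ 2)).
- apply: measurable_funX; apply: measurable_funD;
    by apply: measurable_funM.
- move=> x; rewrite [leRHS]ger0_norm; last first.
    by rewrite addr_ge0// mulr_ge0 ?sqr_ge0// mulr_ge0 ?sqr_ge0.
  rewrite ger0_norm ?sqr_ge0//.
  by have := sqr_ge0 (a * f x - b * g x); lra.
- by apply: integrableD_EFin; exact: integrableZ_EFin.
Qed.

Lemma L2Z_lin (a : R[i]) (xi eta : T -> R[i]) :
  L2Z Z xi -> L2Z Z eta -> L2Z Z (fun x => a * xi x + eta x).
Proof.
move=> /L2ZP[mR mI iR iI] /L2ZP[mR' mI' iR' iI'].
have mT (f : T -> R) : measurable_wrt (Finf Z) f -> measurable_fun setT f.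
  by move=> mf; exact: (measurable_wrt_measurable_fun mZ mf).
have h1 := mT _ mR; have h2 := mT _ mI.
have h3 := mT _ mR'; have h4 := mT _ mI'.
(* The factors 1 give nested combinations of the shape [b * f + c * g], so that [comb] and
   [integrable_sqrD] can each be applied twice. *)
have E1 x : Re (a * xi x + eta x) =
    1 * (Re a * Re (xi x) + - Im a * Im (xi x)) + 1 * Re (eta x).
  by rewrite ReD ReM; ring.
have E2 x : Im (a * xi x + eta x) =
    1 * (Im a * Re (xi x) + Re a * Im (xi x)) + 1 * Im (eta x).
  by rewrite ImD ImM; ring.
have comb (b c : R) (f g : T -> R) : measurable_wrt (Finf Z) f ->
    measurable_wrt (Finf Z) g ->
    measurable_wrt (Finf Z) (fun x => b * f x + c * g x).
  move=> /measurable_wrtP mf /measurable_wrtP mg; apply/measurable_wrtP.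
  by apply: measurable_funD; apply: measurable_funM.
apply/L2ZP; split.
- under eq_fun do rewrite E1.
  by apply: (comb) => //; exact: (comb).
- under eq_fun do rewrite E2.
  by apply: (comb) => //; exact: (comb).
- under eq_fun do rewrite E1.
  apply: integrable_sqrD => //; last exact: integrable_sqrD.
  by apply: mT; exact: (comb).
- under eq_fun do rewrite E2.
  apply: integrable_sqrD => //; last exact: integrable_sqrD.
  by apply: mT; exact: (comb).
Qed.

Lemma inner_ZsE (s : Gam) (xi : T -> R[i]) :
  inner P (Zs Z s) xi =
  (\int[P]_x (zs Z s x * Re (xi x))) +i* (\int[P]_x (zs Z s x * Im (xi x))).
Proof.
have E x : Num.conj (Zs Z s x) = (zs Z s x)%:C by exact: conjc_real.
congr (_ +i* _); apply: eq_Rintegral => x _.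
  by rewrite E ReM /= mul0r subr0.
by rewrite E ImM /= mul0r addr0.
Qed.

Lemma Zs0 : Zs Z fset0 = fun=> 1.
Proof. by apply/funext => x; rewrite /Zs big_seq_fset0. Qed.

Hypothesis hZ : normal_noise Z.

Lemma L2Z_Zs (s : Gam) : L2Z Z (Zs Z s).
Proof.
apply/L2ZP; split => /=.
- exact: (@measurable_zs _ _ _ _ _ setT s).
- by apply/measurable_wrtP; exact: measurable_cst.
- by have [] := zs_orthonormal hZ s s.
- under eq_fun do rewrite expr0n/=.
  exact: finite_measure_integrable_cst.
Qed.

Lemma inner_Zs_lin (s : Gam) (a : R[i]) (xi eta : T -> R[i]) :
  L2Z Z xi -> L2Z Z eta ->
  inner P (Zs Z s) (fun x => a * xi x + eta x) =
  a * inner P (Zs Z s) xi + inner P (Zs Z s) eta.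
Proof.
move=> /L2ZP[mR mI iR iI] /L2ZP[mR' mI' iR' iI'].
have mT (f : T -> R) : measurable_wrt (Finf Z) f -> measurable_fun setT f.
  by move=> mf; exact: (measurable_wrt_measurable_fun mZ mf).
have iM (f : T -> R) : measurable_wrt (Finf Z) f -> Int (fun x => f x ^+ 2) ->
    Int (fun x => zs Z s x * f x).
  move=> mf fi.
  apply: integrableM_sqr => //; [exact: measurable_zsT|exact: mT|].
  by have [] := zs_orthonormal hZ s s.
have h1 := iM _ mR iR; have h2 := iM _ mI iI.
have h3 := iM _ mR' iR'; have h4 := iM _ mI' iI'.
rewrite !inner_ZsE; case: a => a b; apply/eqP; rewrite eq_complex /=.
apply/andP; split; apply/eqP.
- transitivity (\int[P]_x (a * (zs Z s x * Re (xi x)) -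
      b * (zs Z s x * Im (xi x)) + zs Z s x * Re (eta x))).
    by apply: eq_Rintegral => x _; rewrite ReD ReM /=; ring.
  rewrite RintegralD ?RintegralB ?RintegralZl//.
  + exact: integrableZ_EFin.
  + exact: integrableZ_EFin.
  + by apply: integrableB_EFin; exact: integrableZ_EFin.
- transitivity (\int[P]_x (a * (zs Z s x * Im (xi x)) +
      b * (zs Z s x * Re (xi x)) + zs Z s x * Im (eta x))).
    by apply: eq_Rintegral => x _; rewrite ImD ImM /=; ring.
  rewrite !RintegralD ?RintegralZl//.
  + exact: integrableZ_EFin.
  + exact: integrableZ_EFin.
  + by apply: integrableD_EFin; exact: integrableZ_EFin.
Qed.

Lemma inner_Zs (s t : Gam) : inner P (Zs Z s) (Zs Z t) = (s == t)%:R.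
Proof.
rewrite inner_ZsE /=; have [_ ->] := zs_orthonormal hZ s t.
under eq_Rintegral do rewrite mulr0.
rewrite Rintegral_cst// mul0r; by case: (s == t).
Qed.

(** Membership in [L2Z] is proved together with the coefficients, since linearity of [inner] in the
    induction step needs it for the tail. Without [uniq l] the coefficients of repeated sets would
    add up. *)
Lemma inner_Zs_sum (s : Gam) (l : seq Gam) (c : Gam -> R[i]) : uniq l ->
  L2Z Z (fun x => \sum_(t <- l) c t * Zs Z t x) /\
  inner P (Zs Z s) (fun x => \sum_(t <- l) c t * Zs Z t x) =
    if s \in l then c s else 0.
Proof.
elim: l => [_|t l IH /= /andP[tl ul]].
  split.
    under eq_fun do rewrite big_nil.
    apply/L2ZP; split => /=;
      try by apply/measurable_wrtP; exact: measurable_cst.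
    + by under eq_fun do rewrite expr0n/=; exact: finite_measure_integrable_cst.
    + by under eq_fun do rewrite expr0n/=; exact: finite_measure_integrable_cst.
  rewrite inner_ZsE; congr (_ +i* _);
    by under eq_Rintegral do rewrite big_nil mulr0;
       rewrite Rintegral_cst// mul0r.
have [IH1 IH2] := IH ul.
have E : (fun x => \sum_(u <- t :: l) c u * Zs Z u x) =
    (fun x => c t * Zs Z t x + \sum_(u <- l) c u * Zs Z u x).
  by apply/funext => x; rewrite big_cons.
rewrite E; split; first by apply: L2Z_lin => //; exact: L2Z_Zs.
rewrite inner_Zs_lin//; last exact: L2Z_Zs.
rewrite inner_Zs IH2 inE; case: eqP => [->|_] /=.
  by rewrite (negbTE tl) mulr1 addr0.
by rewrite mulr0 add0r.
Qed.

End L2.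

(** * Unordered real series *)

Section rsum.
Local Open Scope complex_scope.
Variables (R : realType) (I : choiceType).
Implicit Types (f g u v : I -> R).

Definition esumR u : \bar R := \esum_(i in [set: I]) (u i)%:E.
Definition fsumR u : R := fine (esumR u).

Lemma esumR_ge0 u : (forall i, 0 <= u i) -> (0 <= esumR u)%E.
Proof. by move=> u0; apply: esum_ge0 => i _; rewrite lee_fin. Qed.

Lemma le_esumR u v : (forall i, u i <= v i) -> (esumR u <= esumR v)%E.
Proof. by move=> uv; apply: le_esum => i _; rewrite lee_fin. Qed.

Lemma esumRD u v : (forall i, 0 <= u i) -> (forall i, 0 <= v i) ->
  esumR (fun i => u i + v i) = (esumR u + esumR v)%E.
Proof. by move=> u0 v0; rewrite -esumD// => i _; rewrite lee_fin. Qed.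

Lemma le_esumRZ (a : R) u : 0 <= a -> (forall i, 0 <= u i) ->
  (esumR (fun i => a * u i)%R <= a%:E * esumR u)%E.
Proof.
move=> a0 u0; apply: ge_ereal_sup => _ [F [finF FI] <-].
rewrite (_ : (\sum_(i \in F) _)%E = (a%:E * \sum_(i \in F) (u i)%:E)%E);
  last first.
  by rewrite !fsbig_finite//= ge0_sume_distrr// => i _; rewrite lee_fin.
apply: lee_wpmul2l; first by rewrite lee_fin.
by apply: esum_ge; exists F.
Qed.

Lemma esumRZ (a : R) u : 0 <= a -> (forall i, 0 <= u i) ->
  esumR (fun i => a * u i) = (a%:E * esumR u)%E.
Proof.
move=> a0 u0; have [->|aN0] := eqVneq a 0.
  by rewrite mul0e /esumR esum1// => i _; rewrite mul0r.
have {aN0 a0}a0 : 0 < a by rewrite lt_neqAle eq_sym aN0.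
apply/eqP; rewrite eq_le le_esumRZ ?(ltW a0)//=.
(* The converse inequality is [le_esumRZ] for the inverse factor and the scaled family. *)
have := @le_esumRZ a^-1 (fun i => a * u i).
rewrite invr_ge0 (ltW a0) => /(_ isT) h.
have {h} := h (fun i => mulr_ge0 (ltW a0) (u0 i)).
rewrite (_ : (fun i => _) = u); last first.
  by apply/funext => i; rewrite mulKf ?gt_eqF.
move=> /(lee_wpmul2l (x := a%:E)); rewrite lee_fin (ltW a0) => /(_ isT).
by rewrite muleA -EFinM divff ?gt_eqF// mul1e.
Qed.

Lemma esumR_fin u : (forall i, 0 <= u i) -> (esumR u < +oo)%E ->
  esumR u \is a fin_num.
Proof. by move=> u0 uoo; rewrite ge0_fin_numE// esumR_ge0. Qed.

Lemma fsumRD u v : (forall i, 0 <= u i) -> (forall i, 0 <= v i) ->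
  (esumR u < +oo)%E -> (esumR v < +oo)%E ->
  fsumR (fun i => u i + v i) = fsumR u + fsumR v.
Proof.
by move=> u0 v0 uoo voo; rewrite /fsumR esumRD// fineD//; exact: esumR_fin.
Qed.

Lemma fsumRZ (a : R) u : 0 <= a -> (forall i, 0 <= u i) ->
  (esumR u < +oo)%E -> fsumR (fun i => a * u i) = a * fsumR u.
Proof.
by move=> a0 u0 uoo; rewrite /fsumR esumRZ// fineM//; exact: esumR_fin.
Qed.

Lemma fsumR_ge0 u : (forall i, 0 <= u i) -> 0 <= fsumR u.
Proof. by move=> u0; apply: fine_ge0; exact: esumR_ge0. Qed.

Lemma le_fsumR u v : (forall i, 0 <= u i) -> (forall i, u i <= v i) ->
  (esumR v < +oo)%E -> fsumR u <= fsumR v.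
Proof.
move=> u0 uv voo; apply: fine_le; [| |exact: le_esumR].
- by apply: esumR_fin => //; apply: le_lt_trans voo; exact: le_esumR.
- by apply: esumR_fin => // i; exact: le_trans (u0 i) (uv i).
Qed.

Definition rsummable f : Prop := (esumR (fun i => `|f i|)%R < +oo)%E.

(** [rsum] is defined by positive and negative parts, which are not additive. Any other
    decomposition into nonnegative summable families gives the same value, and linearity follows by
    choosing convenient ones. *)
Lemma rsum_diff u v : (forall i, 0 <= u i) -> (forall i, 0 <= v i) ->
  (esumR u < +oo)%E -> (esumR v < +oo)%E ->
  rsum (fun i => u i - v i) = fsumR u - fsumR v.
Proof.
move=> u0 v0 uoo voo; rewrite /fsumR -fineB; [|exact: esumR_fin..].
congr fine; apply: (@esumB _ _ setT (EFin \o u) (EFin \o v)).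
- rewrite /summable (_ : esum _ _ = esumR u)//; apply: eq_esum => i _ /=.
  by rewrite ger0_norm.
- rewrite /summable (_ : esum _ _ = esumR v)//; apply: eq_esum => i _ /=.
  by rewrite ger0_norm.
- by move=> i _; rewrite lee_fin.
- by move=> i _; rewrite lee_fin.
Qed.

(** The convenient decomposition is [f = pos f - |f|]: both terms are nonnegative, and the algebra
    needs no case distinction on the sign of [f i]. *)
Let pos f i := `|f i| + f i.

Let pos_ge0 f i : 0 <= pos f i.
Proof. by rewrite /pos; have := ler_norm (- f i); rewrite normrN; lra. Qed.

Let norm_ge0 f i : 0 <= `|f i|. Proof. exact: normr_ge0. Qed.

Let pos_fin f : rsummable f -> (esumR (pos f) < +oo)%E.
Proof.
move=> sf; apply: (@le_lt_trans _ _ (esumR (fun i => `|f i| + `|f i|))).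
  by apply: le_esumR => i; rewrite lerD2l ler_norm.
by rewrite esumRD// lte_add_pinfty.
Qed.

Lemma rsumE f : rsummable f ->
  rsum f = fsumR (fun i => `|f i| + f i) - fsumR (fun i => `|f i|).
Proof.
move=> sf; rewrite -(rsum_diff (pos_ge0 f) (norm_ge0 f) (pos_fin sf) sf).
by congr rsum; apply/funext => i; rewrite /pos; ring.
Qed.

Lemma rsummableZ a f : rsummable f -> rsummable (fun i => a * f i).
Proof.
move=> sf; rewrite /rsummable.
under eq_fun do rewrite normrM.
by rewrite esumRZ// lte_mul_pinfty ?lee_fin.
Qed.

Lemma rsumD f g : rsummable f -> rsummable g ->
  rsum (fun i => f i + g i) = rsum f + rsum g.
Proof.
move=> sf sg.
rewrite (_ : (fun i => f i + g i) =
  (fun i => (pos f i + pos g i) - (`|f i| + `|g i|))); last first.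
  by apply/funext => i; rewrite /pos; ring.
rewrite rsum_diff.
- rewrite (fsumRD (pos_ge0 f) (pos_ge0 g) (pos_fin sf) (pos_fin sg)).
  rewrite (fsumRD (norm_ge0 f) (norm_ge0 g) sf sg).
  by rewrite !rsumE//; rewrite /pos; ring.
- by move=> i; rewrite addr_ge0// pos_ge0.
- by move=> i; rewrite addr_ge0.
- by rewrite esumRD ?lte_add_pinfty ?pos_fin//; exact: pos_ge0.
- by rewrite esumRD// lte_add_pinfty.
Qed.

Lemma rsumZ a f : rsummable f -> rsum (fun i => a * f i) = a * rsum f.
Proof.
move=> sf; have fin (b : R) u : 0 <= b -> (forall i, 0 <= u i) ->
    (esumR u < +oo)%E -> (esumR (fun i => b * u i)%R < +oo)%E.
  by move=> b0 u0 uoo; rewrite esumRZ// lte_mul_pinfty ?lee_fin.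
have pf := pos_fin sf.
have [a0|a0] := leP 0 a.
  rewrite (_ : (fun i => a * f i) = (fun i => a * pos f i - a * `|f i|)).
    rewrite rsum_diff.
    - rewrite (fsumRZ a0 (pos_ge0 f) pf) (fsumRZ a0 (norm_ge0 f) sf).
      by rewrite rsumE// /pos; ring.
    - by move=> i; rewrite mulr_ge0// pos_ge0.
    - by move=> i; rewrite mulr_ge0.
    - exact: (fin _ _ a0 (pos_ge0 f) pf).
    - exact: (fin _ _ a0 (norm_ge0 f) sf).
  by apply/funext => i; rewrite /pos; ring.
(* For negative [a] the two terms of the decomposition exchange roles. *)
have b0 : 0 <= - a by rewrite oppr_ge0 ltW.
rewrite (_ : (fun i => a * f i) = (fun i => (- a) * `|f i| - (- a) * pos f i)).
  rewrite rsum_diff.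
  - rewrite (fsumRZ b0 (pos_ge0 f) pf) (fsumRZ b0 (norm_ge0 f) sf).
    by rewrite rsumE// /pos; ring.
  - by move=> i; rewrite mulr_ge0.
  - by move=> i; rewrite mulr_ge0// pos_ge0.
  - exact: (fin _ _ b0 (norm_ge0 f) sf).
  - exact: (fin _ _ b0 (pos_ge0 f) pf).
by apply/funext => i; rewrite /pos; ring.
Qed.

(** The sum of [pos f] lies between 0 and twice the sum of [|f|]; subtracting the latter once gives
    both bounds. *)
Lemma ler_norm_rsum f : rsummable f ->
  `|rsum f| <= fsumR (fun i => `|f i|).
Proof.
move=> sf; rewrite rsumE//.
have h0 : 0 <= fsumR (pos f) by apply: fsumR_ge0; exact: pos_ge0.
have h1 : fsumR (pos f) <= fsumR (fun i => `|f i|) + fsumR (fun i => `|f i|).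
  rewrite -fsumRD//; apply: le_fsumR; first exact: pos_ge0.
    by move=> i; rewrite lerD2l ler_norm.
  by rewrite esumRD// lte_add_pinfty.
by rewrite ler_norml; apply/andP; split; move: h0 h1; rewrite /pos; lra.
Qed.

Lemma esumR_single u j :
  (forall i, 0 <= u i) -> (forall i, i != j -> u i = 0) ->
  esumR u = (u j)%:E.
Proof.
move=> u0 uj; rewrite /esumR (esumID [set j])//; last first.
  by move=> i _; rewrite lee_fin.
rewrite setTI esum_set1 ?lee_fin// esum1 ?adde0// => i [_ /= ij].
by rewrite uj//; apply/eqP.
Qed.

Lemma rsum_single f j : (forall i, i != j -> f i = 0) -> rsum f = f j.
Proof.
move=> fj; have fj' i : i != j -> `|f i| = 0 by move=> /fj ->; rewrite normr0.
rewrite rsumE /rsummable /fsumR; last by rewrite (esumR_single _ fj')// ltry.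
rewrite (esumR_single _ fj')// (esumR_single (pos_ge0 f) (j := j)).
  by rewrite /= /pos; ring.
by move=> i ij; rewrite /pos fj// normr0 addr0.
Qed.

End rsum.

(** * Unordered complex series *)

Section csum.
Local Open Scope complex_scope.
Variables (R : realType) (I : choiceType).
Implicit Types (f g : I -> R[i]).

Lemma abs_summable_Re f : abs_summable f -> rsummable (fun i => Re (f i)).
Proof.
by move=> sf; apply: le_lt_trans sf; apply: le_esumR => i; exact: Re_le_cmod.
Qed.

Lemma abs_summable_Im f : abs_summable f -> rsummable (fun i => Im (f i)).
Proof.
by move=> sf; apply: le_lt_trans sf; apply: le_esumR => i; exact: Im_le_cmod.
Qed.

Lemma csumD f g : abs_summable f -> abs_summable g ->
  csum (fun i => f i + g i) = csum f + csum g.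
Proof.
move=> sf sg; rewrite /csum.
rewrite (_ : (fun i => Re (f i + g i)) = (fun i => Re (f i) + Re (g i)));
  last first.
  by apply/funext => i; rewrite ReD.
rewrite (_ : (fun i => Im (f i + g i)) = (fun i => Im (f i) + Im (g i)));
  last first.
  by apply/funext => i; rewrite ImD.
by rewrite !rsumD//; [exact: abs_summable_Im|exact: abs_summable_Im|
  exact: abs_summable_Re|exact: abs_summable_Re].
Qed.

Lemma csumZ (a : R[i]) f : abs_summable f ->
  csum (fun i => a * f i) = a * csum f.
Proof.
move=> sf; have sR := abs_summable_Re sf; have sI := abs_summable_Im sf.
rewrite /csum; case: a => a b.
rewrite (_ : (fun i => Re _) = (fun i => a * Re (f i) + - b * Im (f i)));
  last first.
  by apply/funext => i; rewrite ReM /=; ring.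
rewrite (_ : (fun i => Im _) = (fun i => a * Im (f i) + b * Re (f i)));
  last first.
  by apply/funext => i; rewrite ImM /=; ring.
rewrite !rsumD; [|exact: rsummableZ..].
rewrite !rsumZ//; apply/eqP; rewrite eq_complex ReM ImM /= mulNr.
by rewrite !eqxx.
Qed.

Lemma abs_summableZ (a : R[i]) f : abs_summable f ->
  abs_summable (fun i => a * f i).
Proof.
move=> sf; rewrite /abs_summable.
rewrite (_ : esum _ _ = esumR (fun i => cmod a * cmod (f i))); last first.
  by apply: eq_esum => i _; rewrite cmodM.
rewrite (esumRZ (cmod_ge0 a)) => [|i]; last exact: cmod_ge0.
by rewrite lte_mul_pinfty ?lee_fin ?cmod_ge0.
Qed.

(** The factor 2 comes from bounding the real and imaginary sums separately; it is harmless in the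
    epsilon arguments that use it. *)
Lemma cmod_csum_le f : abs_summable f ->
  cmod (csum f) <= 2 * fsumR (fun i => cmod (f i)).
Proof.
move=> sf; apply: le_trans (cmod_le _) _; rewrite /csum /= mulr2n mulrDl mul1r.
apply: lerD.
- apply: le_trans (ler_norm_rsum (abs_summable_Re sf)) _.
  by apply: le_fsumR => // i; exact: Re_le_cmod.
- apply: le_trans (ler_norm_rsum (abs_summable_Im sf)) _.
  by apply: le_fsumR => // i; exact: Im_le_cmod.
Qed.

Lemma csum_single f j : (forall i, i != j -> f i = 0) -> csum f = f j.
Proof.
move=> fj; rewrite /csum (rsum_single (j := j)) => [|i ij]; last by rewrite fj.
rewrite (rsum_single (j := j)) => [|i ij]; last by rewrite fj.
by case: (f j).
Qed.

End csum.

Lemma esumR_seq (R : realType) (I : choiceType) (u : I -> R) (l : seq I) :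
  uniq l -> (forall i, 0 <= u i) -> (forall i, i \notin l -> u i = 0) ->
  esumR u = (\sum_(i <- l) u i)%:E.
Proof.
move=> ul u0 ul0; rewrite /esumR (esumID [set` l])//; last first.
  by move=> i _; rewrite lee_fin.
rewrite setTI [X in (_ + X)%E]esum1 ?adde0; last first.
  by move=> i [_ /= /negP il]; rewrite ul0.
rewrite esum_fset//; last by move=> i _; rewrite lee_fin.
by rewrite -fsbig_seq// sumEFin.
Qed.

(** * Weighted square-summable families over the finite sets *)

Section weighted_l2.
Local Open Scope complex_scope.
Variable R : realType.
Implicit Types (p : R) (f g c : Gam -> R[i]).

(** A squared norm for either sign of [p]: exponent [p] measures coefficients of test functions,
    exponent [- p] measures Fock transforms. *)
Definition wsq p f : \bar R :=
  esumR (fun s => lam R s `^ (2 * p) * cmod (f s) ^+ 2).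

Lemma lam_gt0 (s : Gam) : 0 < lam R s.
Proof. by apply: prodr_gt0 => i _; rewrite ltr0n. Qed.

Lemma lampow_gt0 (s : Gam) p : 0 < lam R s `^ p.
Proof. by rewrite powR_gt0// lam_gt0. Qed.

Lemma wsq_term_ge0 p f (s : Gam) : 0 <= lam R s `^ (2 * p) * cmod (f s) ^+ 2.
Proof. by rewrite mulr_ge0 ?powR_ge0 ?sqr_ge0. Qed.

Lemma wsq_ge0 p f : (0 <= wsq p f)%E.
Proof. by apply: esumR_ge0 => s; exact: wsq_term_ge0. Qed.

Lemma wsq_lin p (a : R[i]) f g : (wsq p f < +oo)%E -> (wsq p g < +oo)%E ->
  (wsq p (fun s => a * f s + g s)%R < +oo)%E.
Proof.
move=> sf sg.
pose u (s : Gam) := (2 * cmod a ^+ 2) * (lam R s `^ (2 * p) * cmod (f s) ^+ 2).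
pose v (s : Gam) := 2 * (lam R s `^ (2 * p) * cmod (g s) ^+ 2).
have a0 : 0 <= 2 * cmod a ^+ 2 by rewrite mulr_ge0 ?sqr_ge0.
have u0 s : 0 <= u s by rewrite mulr_ge0 ?wsq_term_ge0.
have v0 s : 0 <= v s by rewrite mulr_ge0 ?wsq_term_ge0.
apply: (@le_lt_trans _ _ (esumR (fun s => u s + v s)%R)).
  apply: le_esumR => s; have := sqr_cmodD (a * f s) (g s).
  move/(ler_wpM2l (powR_ge0 (lam R s) (2 * p))) => /le_trans; apply.
  by rewrite cmodM exprMn /u /v le_eqVlt; apply/orP; left; apply/eqP; ring.
rewrite esumRD// lte_add_pinfty// esumRZ ?lte_mul_pinfty ?lee_fin//;
  exact: wsq_term_ge0.
Qed.

Lemma lampowN (s : Gam) p : lam R s `^ (2 * - p) = (lam R s `^ (2 * p))^-1.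
Proof. by rewrite mulrN powRN. Qed.

(* AM-GM, with [t] small enough to absorb the norm of a fixed functional. *)
Lemma cmodM_le (t : R) p (s : Gam) (z w : R[i]) : 0 < t ->
  cmod (z * w) <= t / 2 * (lam R s `^ (2 * - p) * cmod z ^+ 2) +
                 (2 * t)^-1 * (lam R s `^ (2 * p) * cmod w ^+ 2).
Proof.
move=> t0; rewrite cmodM lampowN; have l0 := lampow_gt0 s (2 * p).
move: (lam R s `^ _) l0 => l l0.
(* Dividing this square by [l * t] gives twice the difference of the two sides. *)
have := mulr_ge0 (sqr_ge0 (t * cmod z - l * cmod w))
  (ltW (mulr_gt0 (y := t^-1) (x := l^-1) _ _)).
rewrite !invr_gt0 => /(_ l0 t0).
rewrite (_ : _ ^+ 2 * _ = 2 * (t / 2 * (l^-1 * cmod z ^+ 2) +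
  (2 * t)^-1 * (l * cmod w ^+ 2) - cmod z * cmod w)).
  by rewrite pmulr_rge0// subr_ge0.
by field; rewrite !gt_eqF.
Qed.

(** Summing [cmodM_le] over all sets. The value [t = 1] suffices for absolute convergence; a small
    [t] is chosen in the continuity proof of [Sstar_of_coef]. *)
Lemma wsq_pairing (t : R) p f g : 0 < t ->
    (wsq (- p) f < +oo)%E -> (wsq p g < +oo)%E ->
  abs_summable (fun s => f s * g s) /\
  fsumR (fun s => cmod (f s * g s)) <=
    t / 2 * fine (wsq (- p) f) + (2 * t)^-1 * fine (wsq p g).
Proof.
move=> t0 sf sg.
pose u (s : Gam) := t / 2 * (lam R s `^ (2 * - p) * cmod (f s) ^+ 2).
pose v (s : Gam) := (2 * t)^-1 * (lam R s `^ (2 * p) * cmod (g s) ^+ 2).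
have t20 : 0 <= t / 2 by rewrite divr_ge0 ?ltW.
have t20' : 0 <= (2 * t)^-1 by rewrite invr_ge0 mulr_ge0 ?ltW.
have u0 s : 0 <= u s by rewrite mulr_ge0 ?wsq_term_ge0.
have v0 s : 0 <= v s by rewrite mulr_ge0 ?wsq_term_ge0.
have uoo : (esumR u < +oo)%E.
  rewrite esumRZ ?lte_mul_pinfty ?lee_fin//; exact: wsq_term_ge0.
have voo : (esumR v < +oo)%E.
  rewrite esumRZ ?lte_mul_pinfty ?lee_fin//; exact: wsq_term_ge0.
have uv s : cmod (f s * g s) <= u s + v s by exact: cmodM_le.
have uvoo : (esumR (fun s => u s + v s)%R < +oo)%E.
  by rewrite esumRD// lte_add_pinfty.
split; first by apply: le_lt_trans uvoo; exact: le_esumR.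
apply: le_trans (le_fsumR _ uv uvoo) _; first by move=> s; exact: cmod_ge0.
rewrite fsumRD// fsumRZ ?fsumRZ//; exact: wsq_term_ge0.
Qed.

Lemma wsq_le p f g : (forall s, cmod (f s) <= cmod (g s)) ->
  (wsq p f <= wsq p g)%E.
Proof.
move=> fg; apply: le_esumR => s; rewrite ler_wpM2l ?powR_ge0//.
by rewrite ler_sqr ?nnegrE ?cmod_ge0.
Qed.

Lemma wsq_seq p f (l : seq Gam) : uniq l ->
  wsq p (fun s => if s \in l then f s else 0) =
  (\sum_(s <- l) lam R s `^ (2 * p) * cmod (f s) ^+ 2)%:E.
Proof.
move=> ul; rewrite /wsq (esumR_seq ul).
- by congr EFin; rewrite !big_seq; apply: eq_bigr => s ->.
- by move=> s; exact: (wsq_term_ge0 p (fun s => if s \in l then f s else 0)).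
- by move=> s /negbTE ->; rewrite cmod0 expr0n mulr0.
Qed.

(** The weighted space is stable under annihilation. Adjoining [k] maps the sets without [k]
    bijectively onto those with [k] and multiplies [lam] by [k.+1]; the constant [a] compensates for
    the change of weight. *)
Lemma wsq_add p f k : (wsq p f < +oo)%E ->
  (wsq p (fun s => (1 - (k \in s)%:R) * f (k |` s)%fset)%R < +oo)%E.
Proof.
move=> sf.
pose a := k.+1%:R `^ (- (2 * p)) : R.
pose u (s : Gam) := lam R s `^ (2 * p) * cmod (f s) ^+ 2.
have -> : wsq p (fun s => (1 - (k \in s)%:R) * f (k |` s)%fset) =
    \esum_(s in [set s : Gam | k \notin s]) (a * u (k |` s)%fset)%:E.
  rewrite esum_mkcond; apply: eq_esum => s _.
  case: ifPn; rewrite ?inE => ks; last first.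
    rewrite notin_setE /= in ks; move/negP: ks; rewrite negbK => ->.
    by rewrite subrr mul0r cmod0 expr0n mulr0.
  rewrite (negbTE ks) subr0 mul1r /u mulrA; congr ((_ * _)%:E).
  rewrite /lam big_fsetU1//= -/(lam R s) powRM ?ler0n// ?ltW ?lam_gt0//.
  rewrite mulrA /a powRN mulVf ?mul1r// gt_eqF// powR_gt0// ltr0n.
have -> : \esum_(s in [set s : Gam | k \notin s]) (a * u (k |` s)%fset)%:E =
    \esum_(s in [set s : Gam | k \in s]) (a * u s)%:E.
  apply/esym; apply: reindex_esum; split.
  - by move=> s /= _; rewrite in_fset1U eqxx.
  - move=> s t; rewrite !inE/= => ks kt /(congr1 (fun v => v `\ k)%fset).
    by rewrite !fsetU1K.
  - move=> s /= ks; exists (s `\ k)%fset => /=; first by rewrite in_fsetD1 eqxx.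
    by rewrite fsetD1K.
apply: (@le_lt_trans _ _ (esumR (fun s => a * u s)%R)).
  rewrite esum_mkcond; apply: le_esum => s _; case: ifP => // _.
  by rewrite lee_fin mulr_ge0 ?powR_ge0// wsq_term_ge0.
rewrite esumRZ ?lte_mul_pinfty ?lee_fin ?powR_ge0//; exact: wsq_term_ge0.
Qed.

End weighted_l2.

(** * Continuous functionals and their Fock transforms *)

Section functionals.
Local Open Scope complex_scope.
Context (d : measure_display) (T : measurableType d) (R : realType).
Variables (P : probability T R) (Z : nat -> {RV P >-> R}).
Hypothesis hZ : normal_noise Z.

Local Notation coef xi := (fun s : Gam => inner P (Zs Z s) xi).

Lemma sqnormpE p xi : sqnormp Z p xi = wsq p (coef xi).
Proof. by []. Qed.

Lemma sqr_normp p xi : normp Z p xi ^+ 2 = fine (wsq p (coef xi)).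
Proof. by rewrite sqr_sqrtr// fine_ge0// wsq_ge0. Qed.

Lemma Sp_lin p (a : R[i]) xi eta : Sp Z p xi -> Sp Z p eta ->
  Sp Z p (fun x => a * xi x + eta x).
Proof.
move=> [Lxi nxi] [Leta neta]; split; first exact: L2Z_lin.
rewrite sqnormpE.
rewrite (_ : coef _ =
  (fun s => a * inner P (Zs Z s) xi + inner P (Zs Z s) eta)).
  exact: wsq_lin.
by apply/funext => s; rewrite inner_Zs_lin.
Qed.

Lemma Stest_lin (a : R[i]) xi eta : Stest Z xi -> Stest Z eta ->
  Stest Z (fun x => a * xi x + eta x).
Proof. by move=> Sxi Seta p p0; apply: Sp_lin; [exact: Sxi|exact: Seta]. Qed.

Lemma coef_Zs_sum (l : seq Gam) (c : Gam -> R[i]) : uniq l ->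
  coef (fun x => \sum_(t <- l) c t * Zs Z t x) =
  (fun s => if s \in l then c s else 0).
Proof.
by move=> ul; apply/funext => s; have [] := inner_Zs_sum hZ s c ul.
Qed.

Lemma Sp_Zs_sum p (l : seq Gam) (c : Gam -> R[i]) : uniq l ->
  Sp Z p (fun x => \sum_(t <- l) c t * Zs Z t x).
Proof.
move=> ul; split; first by have [] := inner_Zs_sum hZ fset0 c ul.
by rewrite sqnormpE coef_Zs_sum// wsq_seq// ltry.
Qed.

Lemma Sp_Zs p (s : Gam) : Sp Z p (Zs Z s).
Proof.
have := @Sp_Zs_sum p [:: s] (fun=> 1) isT.
by congr (Sp Z p _); apply/funext => x; rewrite big_seq1 mul1r.
Qed.

Lemma Stest_Zs (s : Gam) : Stest Z (Zs Z s).
Proof. by move=> p _; exact: Sp_Zs. Qed.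

Lemma linear_on_sum p (F : functional T R) (l : seq Gam) (c : Gam -> R[i]) :
  linear_on (Sp Z p) F -> uniq l ->
  F (fun x => \sum_(t <- l) c t * Zs Z t x) = \sum_(t <- l) c t * F (Zs Z t).
Proof.
move=> linF; elim: l => [_|t l IH /= /andP[tl ul]].
  (* The value of [F] at 0 is obtained from [linear_on] with scalar -1 and both arguments equal to
     the empty sum. *)
  have /(linF (-1) _ _) := @Sp_Zs_sum p [::] c isT.
  move=> /(_ _ (@Sp_Zs_sum p [::] c isT)); rewrite mulN1r addNr => F0.
  rewrite big_nil -[RHS]F0; congr F; apply/funext => x.
  by rewrite !big_nil mulr0 addr0.
rewrite big_cons -IH// -linF.
- by congr F; apply/funext => x; rewrite big_cons.
- exact: Sp_Zs.
- exact: Sp_Zs_sum.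
Qed.

(* Test the extension [F] on the multiple of
   [\sum_(s <- l) lam^(-2p) F(Z_s)^* Z_s] where it takes the value 1: by
   continuity at 0 the [p]-norm of that vector is bounded below. *)
Lemma fock_wsq p (Phi : functional T R) : 0 <= p -> Spstar Z p Phi ->
  (wsq (- p) (fock Z Phi) < +oo)%E.
Proof.
move=> p0 [_ [F [linF conF _] PhiF]].
(* The zero function is written as an empty sum, so that the lemmas on finite sums apply to it. *)
have Sp0 := @Sp_Zs_sum p [::] (fun=> 0) isT.
have [qs [r [qsP r0 H]]] := conF _ Sp0 1 ltr01.
have bound (l : seq Gam) : uniq l ->
    \sum_(s <- l) lam R s `^ (2 * - p) * cmod (fock Z Phi s) ^+ 2 <=
      (r ^+ 2)^-1.
  move=> ul; set m := (\sum_(s <- l) _); rewrite leNgt; apply/negP => mr.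
  have m0 : 0 < m by apply: lt_trans mr; rewrite invr_gt0 exprn_gt0.
  (* The factor [m^-1] normalises [F eta] to 1, and the squared [p]-norm of [eta] becomes
     [m^-2 * m = m^-1]. If [m] exceeded [(r ^+ 2)^-1], then [eta] would lie in the ball of radius
     [r], where [F] has modulus below 1. *)
  pose c (s : Gam) : R[i] :=
    (m^-1 * lam R s `^ (2 * - p))%:C * Num.conj (fock Z Phi s).
  pose eta x := \sum_(s <- l) c s * Zs Z s x.
  have Seta : Sp Z p eta by exact: Sp_Zs_sum.
  have Feta : F eta = 1.
    rewrite (linear_on_sum c linF ul).
    transitivity ((m^-1 * m)%:C : R[i]); last by rewrite mulVf ?gt_eqF.
    rewrite /m mulr_sumr rmorph_sum; apply: eq_bigr => s _.
    rewrite /c -PhiF; last exact: Stest_Zs.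
    rewrite -/(fock Z Phi s) -mulrA [Num.conj _ * _]mulrC -sqr_normc.
    by rewrite normc_cmod -!rmorphXn -!rmorphM /= -/m; congr (_%:C); ring.
  have F0 : F (fun x => \sum_(t <- [::]) 0 * Zs Z t x) = 0.
    by rewrite (linear_on_sum (fun=> 0) linF)// big_nil.
  have coefE : coef (fun x => eta x - \sum_(t <- [::]) 0 * Zs Z t x) =
      (fun s => if s \in l then c s else 0).
    rewrite -coef_Zs_sum//; apply/funext => s; congr inner; apply/funext => x.
    by rewrite big_nil subr0.
  suff : cmod (F eta - F (fun x => \sum_(t <- [::]) 0 * Zs Z t x)) < 1.
    by rewrite F0 Feta subr0 (cmodR 1) normr1 ltxx.
  apply: H => // q /qsP ->.
  rewrite -ltr_sqr ?nnegrE ?sqrtr_ge0 ?ltW// sqr_normp coefE wsq_seq//=.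
  rewrite (_ : \sum_(s <- l) _ = m^-1).
    by rewrite invf_plt ?posrE// ?exprn_gt0.
  transitivity (m^-1 ^+ 2 * m); last by rewrite expr2 mulfVK ?gt_eqF.
  rewrite [in RHS]/m mulr_sumr; apply: eq_bigr => s _.
  rewrite /c cmodM cmod_conj cmodR ger0_norm; last first.
    by rewrite mulr_ge0 ?invr_ge0 ?ltW ?lampow_gt0.
  have l0 := lampow_gt0 s (2 * p); rewrite lampowN -/m.
  by field; rewrite !gt_eqF.
apply: (@le_lt_trans _ _ ((r ^+ 2)^-1)%:E); last exact: ltry.
apply: ge_ereal_sup => _ [A [finA _] <-].
rewrite fsbig_finite//= sumEFin lee_fin; apply: bound.
exact: fset_uniq.
Qed.

Lemma Sstar_of_coef p (g : Gam -> R[i]) : 0 <= p ->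
  (wsq (- p) g < +oo)%E ->
  exists Psi, Sstar Z Psi /\ forall s, fock Z Psi s = g s.
Proof.
move=> p0 sg.
pose F (xi : T -> R[i]) := csum (fun s => g s * inner P (Zs Z s) xi).
(* The cut-off is required by [dual_of], whose elements vanish outside their domain. *)
pose Psi (xi : T -> R[i]) := if `[< Stest Z xi >] then F xi else 0.
have PsiE xi : Stest Z xi -> Psi xi = F xi by move=> h; rewrite /Psi asboolT.
have sumF xi : Stest Z xi -> abs_summable (fun s => g s * inner P (Zs Z s) xi).
  by move=> /(_ p p0)[_ sxi]; have [] := wsq_pairing ltr01 sg sxi.
have linF a xi eta : Stest Z xi -> Stest Z eta ->
    F (fun x => a * xi x + eta x) = a * F xi + F eta.
  move=> Sxi Seta; rewrite /F -(csumZ a (sumF _ Sxi)).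
  rewrite -(csumD (abs_summableZ a (sumF _ Sxi)) (sumF _ Seta)).
  congr csum; apply/funext => s; rewrite (inner_Zs_lin hZ); first ring.
  - by have [] := Sxi p p0.
  - by have [] := Seta p p0.
exists Psi; split; last first.
  move=> s; rewrite /fock PsiE; last exact: Stest_Zs.
  rewrite /F (csum_single (j := s)) => [|t ts]; rewrite (inner_Zs hZ).
  - by rewrite eqxx mulr1.
  - by rewrite (negbTE ts) mulr0.
split.
- by move=> a xi eta Sxi Seta; rewrite !PsiE//; [exact: linF|exact: Stest_lin].
- move=> xi Sxi e e0.
  pose A := fine (wsq (- p) g).
  have A0 : 0 <= A by rewrite fine_ge0// wsq_ge0.
  (* This gives [t * A < e / 4], and the radius below gives [(2 * t)^-1 * W < e / 4] for the squared
     [p]-norm [W] of the difference. Even after the doubling in [cmod_csum_le] the total stays below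
     [e]. The [+ 1] covers [A = 0]. *)
  pose t := e / (4 * (A + 1)).
  have t0 : 0 < t by rewrite divr_gt0// mulr_gt0// ltr_wpDl.
  exists [:: p], (Num.sqrt (t * e / 2)); split.
  + by move=> q; rewrite inE => /eqP ->.
  + by rewrite sqrtr_gt0 divr_gt0// mulr_gt0.
  + move=> eta Seta /(_ p); rewrite inE eqxx => /(_ isT) nlt.
    have SN : Stest Z (fun x => eta x - xi x).
      have := Stest_lin (-1) Sxi Seta; congr (Stest Z _).
      by apply/funext => x; ring.
    have -> : Psi eta - Psi xi = F (fun x => eta x - xi x).
      rewrite !PsiE//; have := linF (-1) _ _ Sxi Seta.
      rewrite mulN1r addrC => <-; congr F.
      by apply/funext => x; ring.
    have [sp0 sp] := SN p p0.
    have [sm le] := wsq_pairing t0 sg sp.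
    apply: le_lt_trans (cmod_csum_le sm) _.
    have n2 : normp Z p (fun x => eta x - xi x) ^+ 2 < t * e / 2.
      rewrite -[ltRHS]sqr_sqrtr; last by rewrite ltW// divr_gt0// mulr_gt0.
      by rewrite ltr_sqr// ?nnegrE ?sqrtr_ge0.
    rewrite sqr_normp in n2.
    move: le n2; set W := fine (wsq p _); set S := fsumR _; rewrite -/A.
    move=> le n2.
    have tA : t * A < e / 4.
      have : t * (A + 1) = e / 4.
        by rewrite /t; field; rewrite gt_eqF// ltr_wpDl.
      by move: t0; lra.
    have tW : (2 * t)^-1 * W < e / 4.
      rewrite (_ : e / 4 = (2 * t)^-1 * (t * e / 2)).
        by rewrite ltr_pM2l// invr_gt0 mulr_gt0.
      by field; rewrite gt_eqF.
    lra.
- by move=> xi nS; rewrite /Psi asboolF.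
Qed.

(** Existence from [Sstar_of_coef] rules out the default value of [xget]. *)
Lemma fock_of_fock p (g : Gam -> R[i]) : 0 <= p ->
  (wsq (- p) g < +oo)%E -> fock Z (of_fock Z g) =1 g.
Proof.
move=> p0 sg; have h := Sstar_of_coef p0 sg.
by have [_] := xgetPex (fun=> 0) (h : exists Psi,
  [set Psi | Sstar Z Psi /\ forall s, fock Z Psi s = g s] Psi).
Qed.

End functionals.

Lemma bigmaxn_mem (l : seq nat) : l != [::] -> (\max_(i <- l) i)%N \in l.
Proof.
elim: l => [//|i [|j l] IH _]; first by rewrite big_seq1 inE.
rewrite big_cons inE; case: (leqP i (\max_(k <- j :: l) k)) => _.
- by rewrite IH ?orbT.
- by rewrite eqxx.
Qed.

(** * Regrouping an absolutely convergent series *)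

Section partition_of_series.
Local Open Scope complex_scope.
Variables (R : realType) (I : choiceType).
Implicit Types (f g h : I -> R[i]).

Lemma abs_summable_le f h : (forall i, cmod (f i) <= cmod (h i)) ->
  abs_summable h -> abs_summable f.
Proof. by move=> fh; apply: le_lt_trans; exact: le_esumR. Qed.

Lemma esumR_tail (u : I -> R) (e : R) : (forall i, 0 <= u i) ->
  (esumR u < +oo)%E -> 0 < e ->
  exists l : seq I, fsumR (fun i => if i \in l then 0 else u i) < e.
Proof.
move=> u0 uoo e0; have ufin := esumR_fin u0 uoo.
have [_ [A [finA _] <-] lt] := ub_ereal_sup_adherent e0 ufin.
exists (fset_set A).
have {}lt : (esumR u - e%:E < \sum_(i \in A) (u i)%:E)%E by [].
move: lt; rewrite fsbig_finite//= sumEFin.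
rewrite -(fineK ufin) -EFinB lte_fin -/(fsumR u).
pose v i := if i \in fset_set A then u i else 0.
pose w i := if i \in fset_set A then 0 else u i.
have v0 i : 0 <= v i by rewrite /v; case: ifP.
have w0 i : 0 <= w i by rewrite /w; case: ifP.
have vE : esumR v = (\sum_(i <- fset_set A) u i)%:E.
  rewrite (esumR_seq (fset_uniq (fset_set A)))//.
    by rewrite /v !big_seq; congr EFin; apply: eq_bigr => i ->.
  by move=> i /negbTE iA; rewrite /v iA.
have voo : (esumR v < +oo)%E by rewrite vE ltry.
have woo : (esumR w < +oo)%E.
  by apply: le_lt_trans uoo; apply: le_esumR => i; rewrite /w; case: ifP.
have -> : fsumR u = fsumR v + fsumR w.
  rewrite -fsumRD//; congr fsumR; apply/funext => i.
  by rewrite /v /w; case: ifP; rewrite ?addr0 ?add0r.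
by rewrite {1}/fsumR vE /= -/w; lra.
Qed.

(** Dominated convergence for terms that eventually vanish at each index: a finite [l] leaves a tail
    of [h] below [e / 2], and beyond the largest of finitely many thresholds [r n] is 0 on [l]. The
    half absorbs the factor of [cmod_csum_le]. *)
Lemma csum_dominated (r : nat -> I -> R[i]) h : abs_summable h ->
  (forall n i, cmod (r n i) <= cmod (h i)) ->
  (forall i, exists N, forall n, (N <= n)%N -> r n i = 0) ->
  forall e : R, 0 < e ->
    exists N, forall n, (N <= n)%N -> cmod (csum (r n)) < e.
Proof.
move=> sh rh rN e e0.
have h0 i : 0 <= cmod (h i) by exact: cmod_ge0.
have [l lP] := esumR_tail h0 sh (divr_gt0 e0 (ltr0n _ 2)).
have [N NP] : exists N, forall n, (N <= n)%N -> forall i, i \in l -> r n i = 0.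
  elim: l {lP} => [|i l [N NP]]; first by exists 0.
  have [M MP] := rN i; exists (maxn M N) => n.
  rewrite geq_max => /andP[Mn Nn] j.
  by rewrite inE => /predU1P[->|jl]; [exact: MP|exact: NP].
exists N => n Nn.
apply: le_lt_trans (cmod_csum_le (abs_summable_le (rh n) sh)) _.
rewrite mulrC -ltr_pdivlMr//; apply: le_lt_trans lP.
apply: le_fsumR.
- by move=> i; exact: cmod_ge0.
- by move=> i; case: ifPn => // il; rewrite (NP _ Nn)// cmod0.
- by apply: le_lt_trans sh; apply: le_esumR => i; case: ifP.
Qed.

Lemma csum_partition (B : nat -> pred I) (D : pred I) h : abs_summable h ->
  (forall i, D i -> exists k, B k i) -> (forall k i, B k i -> D i) ->
  (forall k k' i, B k i -> B k' i -> k = k') ->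
  series (fun k => csum (fun i => (B k i)%:R * h i) : R[i]^o) @ \oo -->
    (csum (fun i => (D i)%:R * h i) : R[i]^o).
Proof.
move=> sh DB BD Binj.
have cmodb (b : bool) i : cmod (b%:R * h i) <= cmod (h i).
  by case: b; rewrite ?mul1r// mul0r cmod0 cmod_ge0.
have sB (b : pred I) : abs_summable (fun i => (b i)%:R * h i).
  by apply: abs_summable_le sh => i.
pose C n : pred I := fun i => has (B^~ i) (iota 0 n).
have partial n : series (fun k => csum (fun i => (B k i)%:R * h i) : R[i]^o) n =
    csum (fun i => (C n i)%:R * h i).
  rewrite seriesEnat /=; elim: n => [|n IH].
    rewrite big_geq//; transitivity (0 * csum h); first by rewrite mul0r.
    by rewrite -csumZ.
  rewrite big_nat_recr//= IH -csumD//; congr csum; apply/funext => i.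
  rewrite -mulrDl; congr (_ * _).
  rewrite /C -(addn1 n) iotaD has_cat /= orbF add0n -natrD.
  case: (boolP (B n i)) => Bn; last by rewrite orbF addn0.
  rewrite (_ : has _ _ = false)//; apply/hasP => -[k].
  rewrite mem_iota add0n => /andP[_ kn] Bk.
  by rewrite (Binj _ _ _ Bk Bn) ltnn in kn.
have CD n i : C n i -> D i by move=> /hasP[k _]; exact: BD.
pose r n i := ((D i)%:R - (C n i)%:R) * h i.
have rE n i : r n i = (D i && ~~ C n i)%:R * h i.
  rewrite /r; case: (boolP (C n i)) => Ci.
    by rewrite (CD _ _ Ci) subrr.
  by rewrite subr0 andbT.
have rh n i : cmod (r n i) <= cmod (h i) by rewrite rE.
have r0 i : exists N, forall n, (N <= n)%N -> r n i = 0.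
  case: (boolP (D i)) => Di; last first.
    by exists 0 => n _; rewrite rE (negbTE Di) mul0r.
  have [k Bk] := DB _ Di; exists k.+1 => n kn.
  rewrite rE (_ : C n i) ?andbF ?mul0r//.
  by apply/hasP; exists k => //; rewrite mem_iota add0n.
apply/cvgrPdist_lt => e e0.
(* The radius supplied by [cvgrPdist_lt] is a positive element of [R[i]], hence real. *)
have eE : e = (Re e)%:C by rewrite RRe_real// gtr0_real.
have Re0 : 0 < Re e by move: e0; rewrite {1}eE ltcR.
have [N NP] := csum_dominated sh rh r0 Re0.
exists N => // n /= Nn; rewrite partial.
rewrite normc_cmod eE ltcR; move: (NP _ Nn); congr (cmod _ < _).
rewrite -mulN1r -csumZ// -csumD//; last exact: abs_summableZ.
by congr csum; apply/funext => i; rewrite /r; ring.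
Qed.

End partition_of_series.

(** * Fock transforms of the operators, and the covariance identity *)

Section covariance.
Local Open Scope complex_scope.
Context (d : measure_display) (T : measurableType d) (R : realType).
Variables (P : probability T R) (Z : nat -> {RV P >-> R}).
Hypothesis hZ : normal_noise Z.
Variable p : R.
Hypothesis p0 : 0 <= p.

(** The constant 1 is [Zs Z fset0], so orthonormality concentrates the defining family at the empty
    set, and finite support gives the weighted bound for every [Phi]. *)
Lemma fock_expec Phi s :
  fock Z (expec Z Phi) s = fock Z Phi fset0 * (s == fset0)%:R.
Proof.
have E : (fun s : Gam => fock Z Phi fset0 * inner P (fun=> 1) (Zs Z s)) =
    (fun s => if s \in [:: fset0] then fock Z Phi fset0 else 0).
  apply/funext => t; rewrite -(Zs0 Z) inner_Zs// inE eq_sym.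
  by case: eqP; rewrite ?mulr1 ?mulr0.
rewrite /expec E (fock_of_fock hZ p0); last first.
  by rewrite (wsq_seq _ (fun=> fock Z Phi fset0))// ltry.
by rewrite inE; case: eqP; rewrite ?mulr1 ?mulr0.
Qed.

(** The three nested [of_fock] are resolved from the inside out. [wsq_add] supplies the bound for
    [annih]; the other two families are [fock Z Phi] times an indicator, which does not increase the
    norm. *)
Lemma fock_EAA k Phi s : Spstar Z p Phi ->
  fock Z (EAA Z k Phi) s = ((k \in s) && Gam_upto k s)%:R * fock Z Phi s.
Proof.
move=> /(fock_wsq hZ p0) sPhi.
have fa := fock_of_fock hZ p0 (wsq_add k sPhi).
have cb (b : bool) (z : R[i]) : cmod (b%:R * z) <= cmod z.
  by case: b; rewrite ?mul1r// mul0r cmod0 cmod_ge0.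
have E : (fun s : Gam => (k \in s)%:R * fock Z (annih Z k Phi) (s `\ k)%fset) =
    (fun s => (k \in s)%:R * fock Z Phi s).
  (* The set without [k] makes the annihilation factor 1; when [k] is in [t], adjoining it again
     restores [t]. *)
  apply/funext => t; rewrite [fock _ _ _]fa !inE eqxx /= subr0 mul1r.
  by case: (boolP (k \in t)) => kt; rewrite ?mul0r// fsetD1K.
have sc : (wsq (- p) (fun s => (k \in s)%:R * fock Z Phi s)%R < +oo)%E.
  by apply: le_lt_trans sPhi; exact: wsq_le.
have fc t : fock Z (creat Z k (annih Z k Phi)) t = (k \in t)%:R * fock Z Phi t.
  by rewrite /creat E (fock_of_fock hZ p0 sc).
rewrite /EAA /cexpec (fock_of_fock hZ p0).
  by rewrite fc mulrA -natrM mulnb andbC.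
apply: le_lt_trans sPhi; apply: wsq_le => t.
by rewrite fc; apply: le_trans (cb _ _) (cb _ _).
Qed.

Lemma abs_summable_pairing_term Phi Psi : Spstar Z p Phi -> Spstar Z p Psi ->
  pairing_defined Z p Phi Psi.
Proof.
move=> /(fock_wsq hZ p0) sPhi /(fock_wsq hZ p0) sPsi.
pose u (f : Gam -> R[i]) (s : Gam) := lam R s `^ (2 * - p) * cmod (f s) ^+ 2.
have u0 f s : 0 <= u f s by exact: wsq_term_ge0.
apply: (@le_lt_trans _ _
  (esumR (fun s => u (fock Z Phi) s + u (fock Z Psi) s)%R)).
  apply: le_esumR => s; rewrite /pairing_term !cmodM cmod_conj cmodR.
  rewrite ger0_norm ?powR_ge0// /u mulrN -mulrDr -mulrA ler_wpM2l ?powR_ge0//.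
  have := cmod_ge0 (fock Z Phi s); have := cmod_ge0 (fock Z Psi s); nra.
by rewrite esumRD ?lte_add_pinfty.
Qed.

Lemma pairing_term_mul (b : pred Gam) Phi Psi Phi' Psi' :
  (forall s, fock Z Phi' s = (b s)%:R * fock Z Phi s) ->
  (forall s, fock Z Psi' s = (b s)%:R * fock Z Psi s) ->
  pairing_term Z p Phi' Psi' = (fun s => (b s)%:R * pairing_term Z p Phi Psi s).
Proof.
move=> h1 h2; apply/funext => s; rewrite /pairing_term h1 h2.
by case: (b s); rewrite ?mul1r// !(mul0r, mulr0).
Qed.

End covariance.

Theorem theorem4p1 (d : measure_display) (T : measurableType d) (R : realType)
  (P : probability T R) (Z : nat -> {RV P >-> R})
  (hZ : normal_noise Z) (hcrp : chaotic_representation Z)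
  (p : R) (hp : 0 <= p) (Phi Psi : (T -> R[i]) -> R[i])
  (hPhi : Spstar Z p Phi) (hPsi : Spstar Z p Psi) :
  [/\ Cov_defined Z p Phi Psi,
      (forall k, pairing_defined Z p (EAA Z k Phi) (EAA Z k Psi)) &
      series (fun k => pairing Z p (EAA Z k Phi) (EAA Z k Psi) : R[i]^o) @ \oo
        --> (Cov Z p Phi Psi : R[i]^o)].
Proof.
have sh := abs_summable_pairing_term hZ hp hPhi hPsi.
have sb (b : pred Gam) :
    abs_summable (fun s => (b s)%:R * pairing_term Z p Phi Psi s).
  apply: abs_summable_le sh => s.
  by case: (b s); rewrite ?mul1r// mul0r cmod0 cmod_ge0.
(* Together the two conditions say that [k] is the maximum of [s]. The empty set satisfies
   [Gam_upto k] for every [k] but is excluded by the first condition. *)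
pose B k : pred Gam := fun s => (k \in s) && Gam_upto k s.
pose D : pred Gam := fun s => s != fset0.
have EE k : pairing_term Z p (EAA Z k Phi) (EAA Z k Psi) =
    (fun s => (B k s)%:R * pairing_term Z p Phi Psi s).
  by apply: pairing_term_mul => s; exact: (fock_EAA hZ hp).
have Dfock (F : functional T R) s :
    fock Z (F \- expec Z F) s = (D s)%:R * fock Z F s.
  rewrite [LHS](_ : _ = fock Z F s - fock Z (expec Z F) s)//.
  rewrite (fock_expec hZ hp) /D.
  by case: eqP => [->|_]; rewrite ?mulr1 ?mulr0 ?mul1r ?mul0r ?subrr ?subr0.
have ED : pairing_term Z p (Phi \- expec Z Phi) (Psi \- expec Z Psi) =
    (fun s => (D s)%:R * pairing_term Z p Phi Psi s).
  exact: pairing_term_mul.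
split.
- by rewrite /Cov_defined /pairing_defined ED.
- by move=> k; rewrite /pairing_defined EE.
- rewrite /Cov /pairing ED; under eq_fun do rewrite EE.
  apply: csum_partition => //.
  + move=> s sN; exists (\max_(i <- s) i).
    rewrite /B /Gam_upto leqnn andbT.
    apply: bigmaxn_mem; apply: contra_neq sN => s0.
    apply/fsetP => i; rewrite inE.
    by change (i \in enum_fset s = false); rewrite s0.
  + by move=> k s /andP[ks _]; apply/eqP => s0; rewrite s0 inE in ks.
  + move=> k k' s /andP[ks sk] /andP[k's sk']; apply/eqP; rewrite eqn_leq.
    apply/andP; split.
      by apply: leq_trans sk'; apply: (leq_bigmax_seq (F := id)).
    by apply: leq_trans sk; apply: (leq_bigmax_seq (F := id)).
Qed.
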